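(* Let $f\in\mathcal{A}(\Omega)$ and $b\in\mathbb{R}$ satisfy $f-E_kf\le b$ on $\Omega$ for all $k\in\{1,\dots,n\}$. Then for all $t>0$ $$\Pr\{f-Ef>t\}\le \exp\left(\frac{-t^2}{2E[\Sigma^2(f)]+\left(2b/3+J_\mu(f)\right)t}\right).$$
   Context: Let $\Omega=\prod_{k=1}^n\Omega_k$ be a product of measurable spaces, let $\mu_k$ be a probability measure on $\Omega_k$ and $\mu=\prod_k\mu_k$ the product measure on $\Omega$. $\mathcal{A}(\Omega)$ is the algebra of all bounded measurable real-valued functions on $\Omega$. $\Pr$ and $E$ refer to $\mu$, i.e. $Ef=\int_\Omega f\,d\mu$. For $k\in\{1,\dots,n\}$ and $y,y'\in\Omega_k$, the substitution operator is $(S_y^kf)(x_1,\dots,x_n)=f(x_1,\dots,x_{k-1},y,x_{k+1},\dots,x_n)$, and $D^k_{y,y'}=S^k_y-S^k_{y'}$. The conditional expectation and conditional variance operators are $E_kf=\int_{\Omega_k}S_y^kf\,d\mu_k(y)$ and $\sigma_k^2(f)=E_k[(f-E_kf)^2]=\frac12E_{(y,y')\sim\mu_k\times\mu_k}[(D^k_{y,y'}f)^2]$; these are functions on $\Omega$ not depending on $x_k$. The sum of conditional variances is $\Sigma^2(f)=\sum_{k=1}^n\sigma_k^2(f)$. The distribution-dependent interaction functional is $$J_\mu(f)=2\left(\sup_{\mathbf{x}\in\Omega}\sum_{l}\sup_{z\in\Omega_l}\sum_{k:k\ne l}\sigma_k^2\left(f-S_z^lf\right)(\mathbf{x})\right)^{1/2},$$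 with $k,l$ ranging over $\{1,\dots,n\}$. If the denominator in the exponent is zero, the exponent is read as $-\infty$. *)

(* Defs.v *)
From HB Require Import structures.
From mathcomp Require Import all_boot all_order all_algebra.
From mathcomp Require Import all_classical all_reals all_analysis.

Set Implicit Arguments.
Unset Strict Implicit.
Unset Printing Implicit Defensive.

Import Order.TTheory GRing.Theory Num.Theory.
Import numFieldNormedType.Exports.

Local Open Scope classical_set_scope.
Local Open Scope ring_scope.

Definition product_display n (d : 'I_n -> measure_display) : measure_display.
Proof. exact: default_measure_display. Qed.

Section product_space.
Context (n : nat) (d : 'I_n -> measure_display)
        (T : forall k, measurableType (d k)).

Definition product_space : Type := forall k : 'I_n, T k.

HB.instance Definition _ := Pointed.copy product_space (forall k : 'I_n, T k).

Definition product_sigma_algebra : set (set product_space) :=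
  <<s \bigcup_(k : 'I_n) preimage_set_system setT
        (fun x : product_space => x k) measurable >>.

Let product0 : product_sigma_algebra set0.
Proof. exact: sigma_algebra0. Qed.

Let productC A : product_sigma_algebra A -> product_sigma_algebra (~` A).
Proof. exact: sigma_algebraC. Qed.

Let product_bigcup (F : (set product_space)^nat) :
  (forall i, product_sigma_algebra (F i)) ->
  product_sigma_algebra (\bigcup_i (F i)).
Proof. exact: sigma_algebra_bigcup. Qed.

HB.instance Definition _ := @isMeasurable.Build (product_display d)
  product_space product_sigma_algebra product0 productC product_bigcup.

Lemma measurable_coord (k : 'I_n) :
  measurable_fun setT (fun x : product_space => x k).
Proof.
move=> _ A mA; apply: sub_sigma_algebra.
by exists k => //; exists A.
Qed.

Lemma measurable_fun_productP d0 (S : measurableType d0)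
    (g : S -> product_space) :
  (forall k, measurable_fun setT (fun s => g s k)) -> measurable_fun setT g.
Proof.
move=> mg; apply: measurability => //.
move=> _ [_ [k _ [A mA <-]] <-].
rewrite !setTI -[X in measurable X]setTI.
exact: mg.
Qed.

Lemma measurable_box (A : forall k, set (T k)) :
  (forall k, measurable (A k)) ->
  measurable [set x : product_space | forall k, A k (x k)].
Proof.
move=> mA; rewrite (_ : [set x | _] =
    \bigcap_(k in [set: 'I_n]) ((fun x : product_space => x k) @^-1` A k)).
  apply: fin_bigcap_measurable => [|k _]; first exact: finite_finset.
  rewrite -[X in measurable X]setTI.
  exact: measurable_coord.
by apply/seteqP; split=> x Ax k; [move=> _|]; exact: (Ax k).
Qed.

End product_space.

Section product_cons.
Context (n : nat) (d : 'I_n.+1 -> measure_display)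
        (T : forall k, measurableType (d k)).

Definition product_cons
    (x : T ord0 * product_space (fun k : 'I_n => T (lift ord0 k))) :
    product_space T :=
  fun k => match unliftP ord0 k with
  | UnliftSome j e => ecast i (T i) (esym e) (x.2 j)
  | UnliftNone e => ecast i (T i) (esym e) x.1
  end.

Lemma product_cons0 x : product_cons x ord0 = x.1.
Proof.
rewrite /product_cons; case: unliftP => [j e|e].
  by exfalso; have := neq_lift ord0 j; rewrite -e eqxx.
by rewrite eq_axiomK.
Qed.

Lemma product_consS x j : product_cons x (lift ord0 j) = x.2 j.
Proof.
rewrite /product_cons; case: unliftP => [i e|e].
  have ij := lift_inj e; case: i / ij e => e.
  by rewrite eq_axiomK.
by exfalso; have := neq_lift ord0 j; rewrite e eqxx.
Qed.

Lemma measurable_product_cons : measurable_fun setT product_cons.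
Proof.
apply: measurable_fun_productP => k; case: (unliftP ord0 k) => [j ->|->].
  rewrite (_ : (fun x => _) = (fun x => x.2 j)); last first.
    by apply/funext => x; rewrite product_consS.
  exact: (measurableT_comp (measurable_coord
    (T := fun k : 'I_n => T (lift ord0 k)) (k := j)) measurable_snd).
rewrite (_ : (fun x => _) = fst); last first.
  by apply/funext => x; rewrite product_cons0.
exact: measurable_fst.
Qed.

HB.instance Definition _ :=
  isMeasurableFun.Build _ _ _ _ product_cons measurable_product_cons.

End product_cons.

Section product_probability.
Context (R : realType).

(* Built by induction on n, transporting the binary product measure
   mu_0 \x (mu_1 x ... x mu_n) along product_cons; it is characterized by its
   values on boxes, see product_probability_box. *)
Fixpoint product_probability n : forall (d : 'I_n -> measure_display)
    (T : forall k, measurableType (d k)) (mu : forall k, probability (T k) R),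
    probability (product_space T) R :=
  match n with
  | 0 => fun d T mu => \d_ (point : product_space T)
  | m.+1 => fun d T mu =>
      distribution
        (mu ord0 \x product_probability (fun k : 'I_m => mu (lift ord0 k)))%E
        (@product_cons m d T)
  end.

Lemma product_probability_box n (d : 'I_n -> measure_display)
    (T : forall k, measurableType (d k)) (mu : forall k, probability (T k) R)
    (A : forall k, set (T k)) :
  (forall k, measurable (A k)) ->
  product_probability mu [set x | forall k, A k (x k)] =
  (\prod_(k < n) mu k (A k))%E.
Proof.
elim: n => [|n IH] in d T mu A *; move=> mA /=.
  by rewrite big_ord0 diracE mem_set//; case.
rewrite big_ord_recl -IH// /distribution /pushforward/=.
have mAS := measurable_box (fun k : 'I_n => mA (lift ord0 k)).
rewrite -[RHS](product_measure1E _ _ (mA ord0) mAS).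
congr (product_measure1 _ _ _); apply/seteqP; split=> [x Ax|x [Ax1 Ax2] k] /=.
  split=> [|k]/=.
    by have := Ax ord0; rewrite product_cons0.
  by have := Ax (lift ord0 k); rewrite product_consS.
case: (unliftP ord0 k) => [j ->|->]; first by rewrite product_consS.
by rewrite product_cons0.
Qed.

End product_probability.

Section interaction_functional.
Context (R : realType) (n : nat) (d : 'I_n -> measure_display)
        (T : forall k, measurableType (d k)) (mu : forall k, probability (T k) R).
Implicit Types (f : product_space T -> R) (x : product_space T).

Definition subst_op (k : 'I_n) (y : T k) f : product_space T -> R :=
  fun x => f (dfwith x k y).

Definition cond_expectation (k : 'I_n) f : product_space T -> R :=
  fun x => \int[mu k]_y subst_op y f x.

Definition cond_variance (k : 'I_n) f : product_space T -> R :=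
  cond_expectation k (fun x => (f x - cond_expectation k f x) ^+ 2).

Definition sum_cond_variances f : product_space T -> R :=
  fun x => \sum_(k < n) cond_variance k f x.

(* `sup` is the real-valued supremum (0 on an unbounded set); for bounded
   measurable f both suprema below are over nonempty bounded sets. *)
Definition interaction f : R :=
  2 * Num.sqrt (sup [set \sum_(l < n)
        sup [set \sum_(k < n | k != l) cond_variance k (f \- subst_op z f) x
            | z in [set: T l]]
      | x in [set: product_space T]]).

End interaction_functional.

(* Main.v *)
From HB Require Import structures.
Require Import Defs.
From mathcomp Require Import all_boot all_order all_algebra.
From mathcomp Require Import all_classical all_reals all_analysis.
From mathcomp Require Import measurable_realfun ess_sup_inf.
From mathcomp Require Import ring lra.

Set Implicit Arguments.
Unset Strict Implicit.
Unset Printing Implicit Defensive.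

Import Order.TTheory GRing.Theory Num.Theory.
Import numFieldNormedType.Exports.

Local Open Scope classical_set_scope.
Local Open Scope ring_scope.

(** The proof is the entropy method for product measures.

    Write [g] for the sum of conditional variances of [f] and [J] for its
    interaction functional.  Herbst's argument ([herbst]) turns a bound on the
    entropy of [expR (s f)] into a bound on the cumulant generating function of
    [f] at [s], and Chernoff's inequality then gives the tail.  By
    tensorization ([entropy_tensorization]) the entropy under the product
    measure is at most the sum of the mean entropies in one coordinate, and in
    one coordinate the hypothesis [f - E_k f <= b] yields a Bernstein bound
    ([entropy_bernstein]).  Hence the entropy of [expR (s f)] is at most
    [s^2 / (2 (1 - s b / 3)^2)] times the mean of [g expR (s f)].

    This is a mean of [g] for the measure tilted by [expR (s f)], whereas the
    theorem only involves the untilted mean of [g].  The duality between entropy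
    and exponential moments ([entropy_dual_le]) decouples the two: the tilted
    mean of [th g] is at most the normalized entropy of [expR (s f)] plus the
    cumulant generating function of [g] at [th].  The latter is controlled
    because [g] is self-bounding: replacing one coordinate [x_l] changes the
    conditional standard deviations of [f] by at most those of [f - S^l_z f],
    so the squared one-sided oscillations of [g], summed over [l], are at most
    [J^2 g] ([sum_deviation_sqr_le]).  A second use of tensorization and of
    Herbst's argument bounds the cumulant generating function of [g]
    ([cgf_sum_cond_variances_le]).  Choosing [th = s / ((1 - s b / 3) J)] merges
    the two denominators into [1 - s (b / 3 + J / 2)] ([entropy_le_quadratic]).
    As [J] and the mean of [g] may vanish, this is carried out with slightly
    larger numbers, which tend to them at the very end ([tail_le]).

    The one-sided oscillation of [g] in a coordinate would naturally be measured
    from its infimum, but an infimum over an uncountable space need not be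
    measurable.  The essential infimum is measurable in the other coordinates,
    lies almost surely below [g], and is approached by actual values of [g],
    which is all that the argument requires. *)

(** * Elementary real inequalities *)

Section calculus.
Context {R : realType}.
Implicit Types (f df : R -> R) (a b x y : R).

Lemma is_derive_le0_nincr f df a b : a <= b ->
  (forall x, a <= x <= b -> is_derive x 1 f (df x)) ->
  (forall x, a <= x <= b -> df x <= 0) -> f b <= f a.
Proof.
move=> ab fdf df0.
have [||c + fE] := @MVT_segment R f df a b ab.
- by move=> x; rewrite in_itv/= => /andP[ax xb]; apply: fdf; rewrite !ltW.
- apply: derivable_within_continuous => x; rewrite in_itv/= => xab.
  by have [] := fdf x xab.
rewrite in_itv/= => /df0 c0.
by rewrite -subr_le0 fE mulr_le0_ge0// subr_ge0.
Qed.

Lemma is_derive_ge0_ndecr f df a b : a <= b ->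
  (forall x, a <= x <= b -> is_derive x 1 f (df x)) ->
  (forall x, a <= x <= b -> 0 <= df x) -> f a <= f b.
Proof.
move=> ab fdf df0; rewrite -lerN2.
apply: (@is_derive_le0_nincr (- f) (fun x => - df x) a b ab) => x xab.
  by have := fdf x xab => ?; exact: is_deriveN.
by rewrite oppr_le0 df0.
Qed.

(** The Bregman divergence of [z ln z] between [expR y] and [1]; its mean controls
    the entropy of an exponential, see [entropy_le_gap]. *)
Definition entropy_gap (y : R) : R := y * expR y - expR y + 1.

Lemma is_derive_entropy_gap x : is_derive x 1 entropy_gap (x * expR x).
Proof.
rewrite /entropy_gap; apply: is_derive_eq => /=.
rewrite !scaler1 addr0 /GRing.scale/=; ring.
Qed.

Lemma is_derive_bernstein_gap x : x < 3 ->
  is_derive x 1 (fun y => y ^+ 2 / (2 * (1 - y / 3) ^+ 2)) (x / (1 - x / 3) ^+ 3).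
Proof.
move=> x3; have x30 : 1 - x / 3 != 0 by rewrite gt_eqF//; lra.
have dden : is_derive x 1 (fun y : R => 2 * (1 - y / 3) ^+ 2) (- 4 / 3 * (1 - x/3)).
  apply: is_derive_eq => /=.
  by rewrite /GRing.scale/=; field.
have n0 : 2 * (1 - x / 3) ^+ 2 != 0 by rewrite mulf_neq0// expf_neq0.
have dinv := @is_deriveV _ (fun y : R => 2 * (1 - y / 3) ^+ 2) _ _ _ n0 dden.
apply: is_derive_eq => /=.
rewrite /GRing.scale/=; field.
by rewrite /=; lra.
Qed.

(** Both sides vanish at [0], and the derivatives are [y expR y] and
    [y / (1 - y / 3)^3]; so the claim reduces to [1 - y / 3 <= expR (- y / 3)],
    the sign of [y] deciding the direction of monotonicity. *)
Lemma entropy_gap_le y : y < 3 -> entropy_gap y <= y ^+ 2 / (2 * (1 - y / 3) ^+ 2).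
Proof.
move=> y3; rewrite -subr_ge0.
pose h (z : R) := z ^+ 2 / (2 * (1 - z / 3) ^+ 2) - entropy_gap z.
pose dh (z : R) := z * (1 / (1 - z / 3) ^+ 3 - expR z).
have hdh (z : R) : z < 3 -> is_derive z 1 h (dh z).
  move=> z3; have := is_derive_entropy_gap z; have := is_derive_bernstein_gap z3.
  move=> ? ?; rewrite /h; apply: is_derive_eq.
  by rewrite /dh mulrBr mul1r.
have gap0 (z : R) : z < 3 -> 0 <= 1 / (1 - z / 3) ^+ 3 - expR z.
  move=> z3; rewrite subr_ge0 div1r.
  have -> : expR z = (expR (- z / 3) ^+ 3)^-1.
    by rewrite -expRM_natl -expRN; congr expR; field.
  have p0 : 0 < 1 - z / 3 by lra.
  rewrite lef_pV2 ?posrE ?exprn_gt0 ?expR_gt0// lerXn2r ?nnegrE ?expR_ge0//.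
    exact: ltW.
  by have := expR_ge1Dx (- z / 3); apply: le_trans; lra.
have h0 : h 0 = 0 by rewrite /h /entropy_gap expR0; ring.
rewrite -[X in _ <= X]/(h y) -h0; have [y0|y0] := leP 0 y.
  apply: (@is_derive_ge0_ndecr h dh) => // z /andP[z0 zy].
    by apply: hdh; lra.
  by rewrite mulr_ge0// gap0//; lra.
apply: (@is_derive_le0_nincr h dh); first exact: ltW.
  by move=> z /andP[_ z0]; apply: hdh; lra.
by move=> z /andP[_ z0]; rewrite mulr_le0_ge0// gap0//; lra.
Qed.

Lemma expRN_le x : 0 <= x -> expR (- x) <= 1 - x + x ^+ 2 / 2.
Proof.
move=> x0; rewrite -subr_ge0.
pose h (z : R) := 1 - z + z ^+ 2 / 2 - expR (- z).
have h0 : h 0 = 0 by rewrite /h oppr0 expR0; ring.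
rewrite -[X in _ <= X]/(h x) -h0.
apply: (@is_derive_ge0_ndecr h (fun z => -1 + z + expR (- z))) => // z _.
  rewrite /h; apply: is_derive_eq.
  by rewrite /GRing.scale/=; field.
by have := expR_ge1Dx (- z); lra.
Qed.

(** From [expR x <= 1 / (1 - x)], which suffices for the behaviour of cumulant
    generating functions near [0]. *)
Lemma expR_le_sqr x : x <= 2^-1 -> expR x <= 1 + x + 2 * x ^+ 2.
Proof.
move=> x2; have x1 : 0 < 1 - x by lra.
have : expR x <= (1 - x)^-1.
  rewrite -[x in expR x]opprK expRN lef_pV2 ?posrE ?expR_gt0//.
  exact: expR_ge1Dx.
move=> /le_trans; apply; rewrite -div1r ler_pdivrMr//.
have : 0 <= x ^+ 2 * (1 - 2 * x) by rewrite mulr_ge0 ?sqr_ge0//; lra.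
nra.
Qed.

(** The tangent inequality for the convex function [z ln z] at [y]. *)
Lemma xlnx_ge x y : 0 < x -> 0 < y -> x - y <= x * (ln x - ln y).
Proof.
move=> x0 y0.
have : ln (y / x) <= y / x - 1.
  by have := @le_ln1Dx R (y / x - 1); rewrite addrCA subrr addr0; apply; rewrite ltrBrDr addNr divr_gt0.
rewrite ln_div ?posrE// => /(ler_wpM2l (ltW x0)).
have -> : x * (y / x - 1) = y - x by field; rewrite gt_eqF.
by rewrite !mulrBr; lra.
Qed.

End calculus.

(** * Bounded measurable functions and their means *)

Section bounded_measurable.
Context {R : realType} {d} {T : measurableType d}.
Implicit Types (h g : T -> R).

Definition bounded_measurable h :=
  measurable_fun setT h /\ exists M : R, forall x, `|h x| <= M.

Lemma bm_cst c : bounded_measurable (fun=> c).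
Proof. by split; [exact: measurable_cst|exists `|c|]. Qed.

Lemma bmD h g : bounded_measurable h -> bounded_measurable g ->
  bounded_measurable (fun x => h x + g x).
Proof.
move=> [mh [M hM]] [mg [N gN]]; split; first exact: measurable_funD.
by exists (M + N) => x; rewrite (le_trans (ler_normD _ _))// lerD.
Qed.

Lemma bmM h g : bounded_measurable h -> bounded_measurable g ->
  bounded_measurable (fun x => h x * g x).
Proof.
move=> [mh [M hM]] [mg [N gN]]; split; first exact: measurable_funM.
by exists (M * N) => x; rewrite normrM ler_pM.
Qed.

Lemma bmZ c h : bounded_measurable h -> bounded_measurable (fun x => c * h x).
Proof. by move=> bh; apply: bmM => //; exact: bm_cst. Qed.

Lemma bmN h : bounded_measurable h -> bounded_measurable (fun x => - h x).
Proof.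
move=> [mh [M hM]]; split; first exact: measurableT_comp.
by exists M => x; rewrite normrN.
Qed.

Lemma bmB h g : bounded_measurable h -> bounded_measurable g ->
  bounded_measurable (fun x => h x - g x).
Proof. by move=> bh bg; apply: bmD => //; exact: bmN. Qed.

Lemma bm_sqr h : bounded_measurable h -> bounded_measurable (fun x => h x ^+ 2).
Proof. by move=> bh; under eq_fun do rewrite expr2; exact: bmM. Qed.

Lemma bm_sum (I : Type) (s : seq I) (A : pred I) (h : I -> T -> R) :
  (forall i, bounded_measurable (h i)) ->
  bounded_measurable (fun x => \sum_(i <- s | A i) h i x).
Proof.
move=> bh; elim: s => [|i s IH].
  by under eq_fun do rewrite big_nil; exact: bm_cst.
under eq_fun do rewrite big_cons.
by case: (A i) => //; exact: bmD.
Qed.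

Lemma bm_expR h : bounded_measurable h -> bounded_measurable (fun x => expR (h x)).
Proof.
move=> [mh [M hM]]; split; first exact: measurableT_comp.
by exists (expR M) => x; rewrite ger0_norm ?expR_ge0// ler_expR (le_trans (ler_norm _)).
Qed.

Lemma bm_ln c h : 0 < c -> (forall x, c <= h x) -> bounded_measurable h ->
  bounded_measurable (fun x => ln (h x)).
Proof.
move=> c0 ch [mh [M hM]]; split; first exact: measurableT_comp.
have h0 x : 0 < h x by exact: lt_le_trans (ch x).
exists (Num.max (- ln c) (ln M)) => x.
have hxM : h x <= M by rewrite (le_trans (ler_norm _)).
rewrite ler_norml lerNl !le_max lerN2 !ler_ln ?posrE//.
  by rewrite ch hxM orbT.
by rewrite (lt_le_trans (h0 x)).
Qed.

Lemma bm_min h g : bounded_measurable h -> bounded_measurable g ->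
  bounded_measurable (fun x => Num.min (h x) (g x)).
Proof.
move=> [mh [M hM]] [mg [N gN]]; split; first exact: measurable_minr.
exists (Num.max M N) => x; rewrite le_max /Num.min.
by case: ifPn => _; rewrite ?hM ?gN ?orbT.
Qed.

Lemma bm_max h g : bounded_measurable h -> bounded_measurable g ->
  bounded_measurable (fun x => Num.max (h x) (g x)).
Proof.
move=> [mh [M hM]] [mg [N gN]]; split; first exact: measurable_maxr.
exists (Num.max M N) => x; rewrite le_max; rewrite {1 2}/Num.max.
by case: ifPn => _; rewrite ?hM ?gN ?orbT.
Qed.

Lemma bm_integrable (P : probability T R) h :
  bounded_measurable h -> P.-integrable setT (EFin \o h).
Proof.
move=> [mh [M hM]]; apply: measurable_bounded_integrable => //.
  by rewrite -ge0_fin_numE ?fin_num_measure.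
by exists M; split=> [|r Mr x _ /=]; [exact: num_real|rewrite (le_trans (hM x))// ltW].
Qed.

End bounded_measurable.

Lemma bm_comp {R : realType} d d' (S : measurableType d') (T : measurableType d)
    (h : T -> R) (phi : S -> T) : bounded_measurable h ->
  measurable_fun setT phi -> bounded_measurable (fun s => h (phi s)).
Proof. by move=> [mh [M hM]] mphi; split; [exact: measurableT_comp|exists M]. Qed.

#[local] Hint Extern 0 (bounded_measurable _) => exact: bm_cst : core.

Section expectation.
Context {R : realType} {d} {T : measurableType d} (P : probability T R).
Implicit Types (h g : T -> R).

Lemma mean_cst c : \int[P]_x (fun=> c) x = c.
Proof.
have PT : (P : {measure set T -> \bar R}) setT = 1%E := probability_setT P.
by rewrite Rintegral_cst// PT mulr1.
Qed.

Lemma meanD h g : bounded_measurable h -> bounded_measurable g ->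
  \int[P]_x (h x + g x) = \int[P]_x h x + \int[P]_x g x.
Proof. by move=> bh bg; rewrite RintegralD//; exact: bm_integrable. Qed.

Lemma meanB h g : bounded_measurable h -> bounded_measurable g ->
  \int[P]_x (h x - g x) = \int[P]_x h x - \int[P]_x g x.
Proof. by move=> bh bg; rewrite RintegralB//; exact: bm_integrable. Qed.

Lemma meanZ c h : bounded_measurable h ->
  \int[P]_x (c * h x) = c * \int[P]_x h x.
Proof. by move=> bh; rewrite RintegralZl//; exact: bm_integrable. Qed.

Lemma mean_le h g : bounded_measurable h -> bounded_measurable g ->
  (forall x, h x <= g x) -> \int[P]_x h x <= \int[P]_x g x.
Proof.
by move=> bh bg hg; apply: le_Rintegral => //; exact: bm_integrable.
Qed.

(** Comparison through [Num.min h g], which equals [h] almost everywhere and is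
    below [g] everywhere. *)
Lemma mean_le_ae h g : bounded_measurable h -> bounded_measurable g ->
  {ae P, forall x, h x <= g x} -> \int[P]_x h x <= \int[P]_x g x.
Proof.
move=> bh bg hg; have bm := bm_min bh bg.
have -> : \int[P]_x h x = \int[P]_x Num.min (h x) (g x).
  congr fine; apply: ae_eq_integral => //.
  - by apply/measurable_EFinP; case: bh.
  - by apply/measurable_EFinP; case: bm.
  - by apply: filterS hg => x hgx _; rewrite min_l.
by apply: mean_le => // x; rewrite ge_min lexx orbT.
Qed.

Lemma mean_sum n (A : pred 'I_n) (h : 'I_n -> T -> R) :
  (forall i, bounded_measurable (h i)) ->
  \int[P]_x (\sum_(i < n | A i) h i x) = \sum_(i < n | A i) \int[P]_x h i x.
Proof.
move=> bh; have bs (s : seq 'I_n) :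
    bounded_measurable (fun x => \sum_(i <- s | A i) h i x).
  by apply: bm_sum.
elim: (index_enum _) => [|i s IH].
  by under eq_Rintegral do rewrite big_nil; rewrite big_nil mean_cst.
under eq_Rintegral do rewrite big_cons; rewrite big_cons.
by case: (A i) => //; rewrite meanD// IH.
Qed.

Lemma mean_norm_le h M : bounded_measurable h -> (forall x, `|h x| <= M) ->
  `|\int[P]_x h x| <= M.
Proof.
move=> bh hM; rewrite ler_norml; apply/andP; split.
  rewrite -(mean_cst (- M)); apply: mean_le => // x.
  by have := hM x; rewrite ler_norml => /andP[].
rewrite -[leRHS](mean_cst M); apply: mean_le => // x.
by have := hM x; rewrite ler_norml => /andP[].
Qed.

End expectation.

(** * Entropy of an exponential *)

Section entropy.
Context {R : realType} {d} {T : measurableType d} (P : probability T R).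
Implicit Types (h g v X Y : T -> R).

Definition entropy h : R :=
  \int[P]_x (h x * ln (h x)) - \int[P]_x h x * ln (\int[P]_x h x).

Lemma mean_expR_gt0 Y : bounded_measurable Y -> 0 < \int[P]_x expR (Y x).
Proof.
move=> bY; have [_ [M YM]] := bY.
apply: (@lt_le_trans _ _ (expR (- M))); first exact: expR_gt0.
rewrite -(mean_cst P (expR (- M))); apply: mean_le => //; first exact: bm_expR.
by move=> x; rewrite ler_expR; have := YM x; rewrite ler_norml => /andP[].
Qed.

(** One half of the variational formula for entropy (the Gibbs, or
    Donsker-Varadhan, principle): pointwise, the tangent inequality compares
    [expR (Y x)] with [m expR (v x)], where [m] is the mean of [expR Y]. *)
Lemma entropy_dual_le Y v : bounded_measurable Y -> bounded_measurable v ->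
  \int[P]_x expR (v x) <= 1 ->
  \int[P]_x (expR (Y x) * v x) <= entropy (fun x => expR (Y x)).
Proof.
move=> bY bv v1; set m := \int[P]_x expR (Y x).
have m0 : 0 < m by exact: mean_expR_gt0.
have bh := bm_expR bY; have bev := bm_expR bv.
have pw x : expR (Y x) * v x <=
    expR (Y x) * Y x - ln m * expR (Y x) - (expR (Y x) - m * expR (v x)).
  have mv : 0 < m * expR (v x) by rewrite mulr_gt0// expR_gt0.
  have := xlnx_ge (expR_gt0 (Y x)) mv.
  by rewrite lnM ?posrE ?expR_gt0// !expRK !(mulrDr, mulrBr, mulrN, opprD); lra.
have b1 : bounded_measurable (fun x => expR (Y x) * Y x) by exact: bmM.
have b2 : bounded_measurable (fun x => ln m * expR (Y x)) by exact: bmZ.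
have b3 : bounded_measurable (fun x => m * expR (v x)) by exact: bmZ.
have b12 := bmB b1 b2; have bh3 := bmB bh b3.
apply: (le_trans (mean_le P (bmM bh bv) (bmB b12 bh3) pw)).
rewrite !meanB// !meanZ// -/m /entropy -/m.
under [X in _ <= X - _]eq_Rintegral do rewrite expRK.
have : m * (1 - \int[P]_x expR (v x)) >= 0 by rewrite mulr_ge0 ?subr_ge0// ltW.
by rewrite mulrBr mulr1 (mulrC m (ln m)); lra.
Qed.

(** The other variational formula: the mean of the Bregman divergences of
    [z ln z] from [expR u] is smallest when [expR u] is the mean of [expR Y], where
    it equals the entropy; any other [u] gives an upper bound. *)
Lemma entropy_le_gap Y u : bounded_measurable Y ->
  entropy (fun x => expR (Y x)) <=
  \int[P]_x (expR u * entropy_gap (Y x - u)).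
Proof.
move=> bY; set m := \int[P]_x expR (Y x).
have m0 : 0 < m by exact: mean_expR_gt0.
have bh := bm_expR bY.
have -> : (fun x => expR u * entropy_gap (Y x - u)) =
    (fun x => expR (Y x) * Y x - (1 + u) * expR (Y x) + expR u).
  apply/funext => x; rewrite /entropy_gap expRB.
  by field; rewrite gt_eqF// expR_gt0.
have b1 : bounded_measurable (fun x => expR (Y x) * Y x) by exact: bmM.
have b2 : bounded_measurable (fun x => (1 + u) * expR (Y x)) by exact: bmZ.
have b12 := bmB b1 b2.
rewrite meanD// meanB// meanZ// mean_cst /entropy -/m.
under [X in X - _ <= _]eq_Rintegral do rewrite expRK.
have := xlnx_ge m0 (expR_gt0 u); rewrite expRK mulrBr; lra.
Qed.

(** When [u] lies below [Y], the gap [expR u * entropy_gap (Y - u)] is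
    [expR Y] times [expR (- z) - 1 + z] with [z = Y - u >= 0], hence at most
    [expR Y * z^2 / 2].  The positive part keeps the bound meaningful at the
    points of the null set where [u] exceeds [Y]. *)
Lemma entropy_le_sqr Y u : bounded_measurable Y ->
  {ae P, forall x, u <= Y x} ->
  entropy (fun x => expR (Y x)) <=
  \int[P]_x (2^-1 * (expR (Y x) * Num.max (Y x - u) 0 ^+ 2)).
Proof.
move=> bY uY; apply: le_trans (entropy_le_gap u bY) _.
have bh := bm_expR bY.
have bYu : bounded_measurable (fun x => Y x - u) by exact: bmB.
apply: mean_le_ae.
- apply: bmZ; apply: bmD => //; apply: bmB; last exact: bm_expR.
  by apply: bmM => //; exact: bm_expR.
- by apply: bmZ; apply: bmM => //; apply: bm_sqr; exact: bm_max.
- apply: filterS uY => x ux; rewrite max_l ?subr_ge0//.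
  have yu0 : 0 <= Y x - u by rewrite subr_ge0.
  have := expRN_le yu0; rewrite -(ler_pM2l (expR_gt0 (Y x))).
  rewrite /entropy_gap opprB !expRB => le1.
  rewrite -subr_ge0; move: le1; rewrite -subr_ge0; congr (_ <= _).
  by field; rewrite ?gt_eqF ?expR_gt0.
Qed.

(** Jensen's inequality for the exponential, from its tangent at the mean. *)
Lemma expR_mean_le s X : bounded_measurable X ->
  expR (s * \int[P]_x X x) <= \int[P]_x expR (s * X x).
Proof.
move=> bX; set m := \int[P]_x X x.
have bsX : bounded_measurable (fun x => s * X x) by exact: bmZ.
have bl : bounded_measurable (fun x => expR (s * m) * (1 + (s * X x - s * m))).
  by apply: bmZ; apply: bmD => //; exact: bmB.
have := mean_le P bl (bm_expR bsX); rewrite meanZ; last first.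
  by apply: bmD => //; exact: bmB.
rewrite meanD//; last by exact: bmB.
rewrite meanB// meanZ// !mean_cst subrr addr0 mulr1; apply => x.
have -> : s * X x = s * m + (s * X x - s * m) by rewrite addrC subrK.
rewrite expRD ler_pM2l ?expR_gt0//.
by apply: le_trans (expR_ge1Dx _); lra.
Qed.

(** Apply [entropy_le_gap] at the mean: [entropy_gap_le] makes the gap quadratic
    in the deviation, with a constant controlled by the one-sided bound [b].
    The remaining factor [expR (s E X)] is absorbed by Jensen. *)
Lemma entropy_bernstein X b s : bounded_measurable X ->
  (forall x, X x - \int[P]_x X x <= b) -> 0 <= s -> s * b < 3 ->
  entropy (fun x => expR (s * X x)) <=
  s ^+ 2 / (2 * (1 - s * b / 3) ^+ 2) *
  (\int[P]_x (X x - \int[P]_x X x) ^+ 2 * \int[P]_x expR (s * X x)).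
Proof.
move=> bX Xb s0 sb; set m := \int[P]_x X x.
have bsX : bounded_measurable (fun x => s * X x) by exact: bmZ.
apply: le_trans (entropy_le_gap (s * m) bsX) _.
have sb0 : 0 < 1 - s * b / 3 by lra.
have bdev : bounded_measurable (fun x => (X x - m) ^+ 2).
  by apply: bm_sqr; exact: bmB.
have c0 : 0 <= s ^+ 2 / (2 * (1 - s * b / 3) ^+ 2).
  by rewrite divr_ge0 ?sqr_ge0// mulr_ge0// sqr_ge0.
have bYu : bounded_measurable (fun x => s * X x - s * m) by exact: bmB.
set c := s ^+ 2 / _ in c0 *.
apply: (@le_trans _ _ (\int[P]_x (expR (s * m) * c * (X x - m) ^+ 2))).
  apply: mean_le => [||x].
  - apply: bmZ; apply: bmD => //; apply: bmB; last exact: bm_expR.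
    by apply: bmM => //; exact: bm_expR.
  - exact: bmZ.
  rewrite -mulrA ler_pM2l ?expR_gt0// -mulrBr.
  have yb : s * (X x - m) <= s * b by rewrite ler_wpM2l.
  have y3 : s * (X x - m) < 3 by exact: le_lt_trans sb.
  apply: le_trans (entropy_gap_le y3) _.
  rewrite exprMn /c [leRHS]mulrAC ler_wpM2l//; first by apply: mulr_ge0; exact: sqr_ge0.
  have yb0 : 1 - s * b / 3 <= 1 - s * (X x - m) / 3 by lra.
  rewrite lef_pV2 ?posrE ?mulr_gt0 ?exprn_gt0 ?(lt_le_trans sb0 yb0)//.
  by rewrite ler_pM2l// lerXn2r// nnegrE ltW// (lt_le_trans sb0).
rewrite meanZ// -/m mulrAC [leLHS]mulrC ler_wpM2l//.
rewrite [leLHS]mulrC ler_wpM2l//; first by apply: Rintegral_ge0 => x _; exact: sqr_ge0.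
exact: expR_mean_le.
Qed.

End entropy.

(** * Herbst's argument *)

Section herbst.
Context {R : realType} {d} {T : measurableType d} (P : probability T R).
Implicit Types (X : T -> R).

(** Differentiation under the integral sign, the derivative in the parameter
    being dominated by a constant on the unit neighbourhood of [s]. *)
Lemma is_derive_mgf X (s : R) : bounded_measurable X ->
  is_derive s 1 (fun s : R => \int[P]_x expR (s * X x)) (\int[P]_x (X x * expR (s * X x))).
Proof.
move=> bX; have [mX [M XM]] := bX.
have bsX r : bounded_measurable (fun x => r * X x) by exact: bmZ.
have M0 : 0 <= M by exact: le_trans (XM point).
pose u := s - 1; pose v := s + 1.
have Is : `]u, v[%classic s by rewrite /= in_itv/= /u /v; apply/andP; split; lra.
have dE (r : R) x : is_derive r 1 (fun r : R => expR (r * X x)) (X x * expR (r * X x)).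
  apply: is_derive_eq => /=.
  by rewrite /GRing.scale/=; ring.
have d1E r x : partial1of2 (fun r x => expR (r * X x)) r x = X x * expR (r * X x).
  by rewrite partial1of2E; have := dE r x => ?; rewrite derive_val.
pose G (x : T) : R := M * expR ((`|s| + 1) * M).
have intf (r : R) : `]u, v[%classic r -> P.-integrable setT (EFin \o (fun x => expR (r * X x))).
  by move=> _; apply: bm_integrable; exact: bm_expR.
have derf (r : R) x : `]u, v[%classic r -> [set: T] x -> derivable (fun r : R => expR (r * X x)) r 1.
  by move=> _ _; have [] := dE r x.
have G0 x : 0 <= G x by rewrite mulr_ge0 ?expR_ge0.
have iG : P.-integrable setT (EFin \o G) by apply: bm_integrable; exact: bm_cst.
have GX (r : R) x : `]u, v[%classic r -> [set: T] x ->
    `|partial1of2 (fun r x => expR (r * X x)) r x| <= G x.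
  rewrite /= in_itv/= => /andP[ur rv] _; rewrite d1E normrM ler_pM//.
  rewrite ger0_norm ?expR_ge0// ler_expR (le_trans (ler_norm _))// normrM ler_pM//.
  rewrite ler_norml; have := ler_norm s; have := ler_norm (- s).
  by rewrite normrN /u /v in ur rv *; lra.
have dd := derivable_under_integral measurableT Is intf derf G0 iG GX.
have := differentiation_under_integral measurableT Is intf derf G0 iG GX.
under eq_Rintegral do rewrite d1E.
rewrite derive1E => <-; exact/derivableP.
Qed.

(** The cumulant generating function of [X]. *)
Definition cgf X (s : R) := ln (\int[P]_x expR (s * X x)).

Lemma is_derive_cgf X (s : R) : bounded_measurable X ->
  is_derive s 1 (cgf X)
    ((\int[P]_x (X x * expR (s * X x))) / \int[P]_x expR (s * X x)).
Proof.
move=> bX; have m0 := mean_expR_gt0 P (bmZ s bX).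
have dm := is_derive_mgf s bX; have dl := is_derive1_ln m0.
rewrite /cgf; apply: is_derive_eq.
by rewrite mulrC.
Qed.

Lemma entropy_cgf X s : bounded_measurable X ->
  entropy P (fun x => expR (s * X x)) =
  s * (\int[P]_x (X x * expR (s * X x))) - (\int[P]_x expR (s * X x)) * cgf X s.
Proof.
move=> bX; rewrite /entropy; congr (_ - _).
rewrite -meanZ; last first.
  by apply: bmM => //; apply: bm_expR; exact: bmZ.
by apply: eq_Rintegral => x _; rewrite expRK; ring.
Qed.

(** The behaviour at [0] that serves as initial condition in [herbst]. *)
Lemma cgf_le_linear X : bounded_measurable X -> exists2 C, 0 < C &
  forall e, 0 < e -> e <= C^-1 -> cgf X e <= e * (\int[P]_x X x + C * e).
Proof.
move=> bX; have [_ [M XM]] := bX.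
have M0 : 0 <= M by exact: le_trans (XM point).
pose C := 2 * (1 + M ^+ 2) + 2 * M; have C0 : 0 < C.
  by rewrite ltr_wpDr ?mulr_ge0// mulr_gt0// ltr_wpDr// sqr_ge0.
exists C => // e e0 eC.
have m0 := mean_expR_gt0 P (bmZ e bX).
have : cgf X e <= \int[P]_x expR (e * X x) - 1.
  have := @le_ln1Dx R (\int[P]_x expR (e * X x) - 1).
  by rewrite addrCA subrr addr0; apply; rewrite ltrBrDr addNr.
move=> /le_trans; apply.
have bl : bounded_measurable (fun x => 1 + e * X x + 2 * (e * X x) ^+ 2).
  apply: bmD; first by apply: bmD => //; exact: bmZ.
  by apply: bmZ; apply: bm_sqr; exact: bmZ.
have bl' : bounded_measurable (fun x => (1 + 2 * (e * M) ^+ 2) + e * X x).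
  by apply: bmD => //; exact: bmZ.
rewrite lerBlDr; apply: (@le_trans _ _ (\int[P]_x (1 + 2 * (e * M) ^+ 2 + e * X x))).
  apply: mean_le => //; first by apply: bm_expR; exact: bmZ.
  move=> x; apply: le_trans (@expR_le_sqr R (e * X x) _) _.
    apply: (@le_trans _ _ (C^-1 * M)).
      apply: le_trans (ler_norm _) _; rewrite normrM ler_pM//.
      by rewrite gtr0_norm.
    rewrite mulrC ler_pdivrMr// /C; have := sqr_ge0 M; nra.
  rewrite addrAC -!addrA lerD2l lerD2r ler_pM2l//.
  have : (e * X x) ^+ 2 <= (e * M) ^+ 2.
    rewrite !exprMn ler_wpM2l ?sqr_ge0// -real_normK ?num_real//.
    by rewrite lerXn2r ?nnegrE.
  by [].
rewrite meanD//; last exact: bmZ.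
rewrite mean_cst meanZ// exprMn mulrDr /C.
have := sqr_ge0 M; have := sqr_ge0 e; have := mulr_ge0 (sqr_ge0 e) M0; nra.
Qed.

(** The derivative of [cgf X r / r] is the entropy of [expR (r X)] divided by
    [r^2] times its mean, so [cgf X r / r - G r] is nonincreasing; near [0] its
    upper limit is at most the mean of [X] because [G] is nonnegative.  The
    function [G] may itself involve [cgf X], which is how a self-bounding [X] is
    treated. *)
Lemma herbst X (G dG : R -> R) (s : R) : bounded_measurable X -> 0 < s ->
  (forall r, 0 < r <= s -> is_derive r 1 G (dG r)) ->
  (forall r, 0 < r <= s -> 0 <= G r) ->
  (forall r, 0 < r <= s -> entropy P (fun x => expR (r * X x)) <=
     r ^+ 2 * dG r * \int[P]_x expR (r * X x)) ->
  cgf X s <= s * (\int[P]_x X x + G s).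
Proof.
move=> bX s0 GdG G0 ent; have [C C0 lin] := cgf_le_linear bX.
rewrite -ler_pdivrMl//; apply/ler_addgt0Pr => e e0.
(* [r] is small enough for the linear bound to cost at most [e]. *)
pose r := Num.min s (Num.min C^-1 (e / C)).
have r0 : 0 < r by rewrite !lt_min s0 invr_gt0 C0 divr_gt0.
have rs : r <= s by rewrite ge_min lexx.
have rC : r <= C^-1 by rewrite !ge_min lexx orbT.
have re : C * r <= e by rewrite mulrC -ler_pdivlMr// !ge_min lexx !orbT.
pose psi (r : R) := r^-1 * cgf X r - G r.
pose dpsi (r : R) := r ^- 2 / (\int[P]_x expR (r * X x)) *
  entropy P (fun x => expR (r * X x)) - dG r.
have : psi s <= psi r.
  apply: (@is_derive_le0_nincr _ psi dpsi) => // q /andP[rq qs];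
    have q0 : 0 < q by exact: lt_le_trans rq.
    have qn0 : q != 0 by rewrite gt_eqF.
    have dc := is_derive_cgf q bX; have dG' := GdG q; rewrite q0 qs in dG'.
    have {}dG' := dG' isT.
    have di := @is_deriveV R id q 1 1 qn0 (is_derive_id _ _).
    rewrite /psi; apply: is_derive_eq.
    rewrite /dpsi entropy_cgf// /GRing.scale/= mulr1; field.
    by rewrite qn0 gt_eqF//; apply: mean_expR_gt0; exact: bmZ.
  have m0 := mean_expR_gt0 P (bmZ q bX).
  rewrite /dpsi subr_le0 -invfM mulrC ler_pdivrMr ?mulr_gt0 ?exprn_gt0//.
  by apply: le_trans (ent q _) _; rewrite ?q0//; lra.
rewrite /psi; have := lin r r0 rC; rewrite -ler_pdivrMl// => l1 l2.
have := G0 r; rewrite r0 rs => /(_ isT); lra.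
Qed.

End herbst.

(** * Resampling one coordinate of a product space *)

Section substitution.
Context (n : nat) (d : 'I_n -> measure_display)
        (T : forall k, measurableType (d k)).
Implicit Types (x : product_space T).

Lemma dfwith_idem x k (y z : T k) : dfwith (dfwith x k y) k z = dfwith x k z.
Proof.
apply: functional_extensionality_dep => j; have [<-|kj] := eqVneq k j.
  by rewrite !dfwithin.
by rewrite !dfwithout.
Qed.

Lemma dfwithC x k l (y : T k) (z : T l) : k != l ->
  dfwith (dfwith x k y) l z = dfwith (dfwith x l z) k y.
Proof.
move=> kl; apply: functional_extensionality_dep => j.
have [ej|kj] := eqVneq k j.
  by move: kl; case: j / ej => kl; rewrite dfwithin dfwithout 1?eq_sym// dfwithin.
rewrite [RHS]dfwithout//; have [ej|lj] := eqVneq l j.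
  by case: j / ej kj => kj; rewrite !dfwithin.
by rewrite !dfwithout.
Qed.

(** Uncurried so that it is a random element of the product measure
    of the whole space and of one factor. *)
Definition resample k (xy : product_space T * T k) : product_space T :=
  dfwith xy.1 k xy.2.

Lemma measurable_resample k : measurable_fun setT (@resample k).
Proof.
apply: measurable_fun_productP => j; have [ej|kj] := eqVneq k j.
  case: j / ej; rewrite (_ : (fun xy => @resample k xy k) = snd); first exact: measurable_snd.
  by apply/funext => x; rewrite /resample dfwithin.
rewrite (_ : (fun xy => @resample k xy j) = (fun xy => xy.1 j)); last first.
  by apply/funext => x; rewrite /resample dfwithout.
exact: (measurableT_comp (measurable_coord (T := T) (k := j)) measurable_fst).
Qed.

HB.instance Definition _ k :=
  isMeasurableFun.Build _ _ _ _ (@resample k) (@measurable_resample k).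

Lemma measurable_dfwith x k : measurable_fun setT (fun y : T k => dfwith x k y : product_space T).
Proof.
apply: measurable_fun_productP => j; have [ej|kj] := eqVneq k j.
  case: j / ej; rewrite (_ : (fun y => dfwith x k y k) = id); first exact: measurable_id.
  by apply/funext => y; rewrite dfwithin.
rewrite (_ : (fun y => dfwith x k y j) = cst (x j)); first exact: measurable_cst.
by apply/funext => y; rewrite dfwithout.
Qed.

Lemma measurable_subst k (z : T k) :
  measurable_fun setT (fun x : product_space T => dfwith x k z : product_space T).
Proof.
exact: (measurableT_comp (@measurable_resample k) (pair2_measurable z)).
Qed.

(** The pi-system on which product measures are compared. *)
Definition boxes : set (set (product_space T)) :=
  [set B | exists2 A : forall k, set (T k), (forall k, measurable (A k)) &
     B = [set x | forall k, A k (x k)]].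

Lemma measurable_boxes : measurable = <<s boxes >>.
Proof.
apply/seteqP; split.
  apply: smallest_sub; first exact: smallest_sigma_algebra.
  move=> _ [k _ [A mA <-]]; apply: sub_gen_smallest.
  exists (dfwith (fun j => [set: T j]) k A) => [j|].
    have [ej|kj] := eqVneq k j; last by rewrite dfwithout.
    by case: j / ej; rewrite dfwithin.
  rewrite setTI; apply/seteqP; split=> [x Ax j|x /(_ k)]; last by rewrite dfwithin.
  have [ej|kj] := eqVneq k j; last by rewrite dfwithout.
  by case: j / ej; rewrite dfwithin.
apply: smallest_sub; first exact: sigma_algebra_measurable.
by move=> _ [A mA ->]; exact: measurable_box.
Qed.

Lemma setI_closed_boxes : setI_closed boxes.
Proof.
move=> _ _ [A mA ->] [B mB ->]; exists (fun k => A k `&` B k).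
  by move=> k; exact: measurableI.
apply/seteqP; split=> [x [Ax Bx] k|x ABx]; first by split.
by split=> k; have [] := ABx k.
Qed.

Context {R : realType} (mu : forall k, probability (T k) R).
Local Notation P := (product_probability mu).

(** Resampling a coordinate preserves the product measure: on a box, the
    constraint on the old coordinate [k] disappears and reappears on the new
    one. *)
Lemma distribution_resample k A : measurable A ->
  distribution (P \x mu k)%E (@resample k) A = P A.
Proof.
apply: (measure_unique boxes (fun=> setT)).
- exact: measurable_boxes.
- exact: setI_closed_boxes.
- move=> _; exists (fun k => setT) => //.
  by apply/seteqP; split.
- by apply/seteqP; split=> // x _; exists 0%N.
- move=> _ [B mB ->]; apply: etrans _ (esym (product_probability_box mu mB)).
  transitivity ((P \x mu k)%E
      (@resample k @^-1` [set x : product_space T | forall k, B k (x k)])); first by [].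
  (* The box [B] with its constraint on coordinate [k] removed. *)
  pose B' : forall j, set (T j) := dfwith B k setT.
  have mB' j : measurable (B' j).
    rewrite /B'; have [ej|kj] := eqVneq k j; last by rewrite dfwithout.
    by case: j / ej; rewrite dfwithin.
  rewrite (_ : _ @^-1` _ = [set x : product_space T | forall j, B' j (x j)] `*` B k).
    rewrite product_measure1E//; last exact: measurable_box.
    apply: etrans (congr1 (fun z => z * mu k (B k))%E (product_probability_box mu mB')) _.
    rewrite (bigD1 k)//= [RHS](bigD1 k)//=.
    rewrite {1}/B' dfwithin probability_setT mul1e muleC; congr (_ * _)%E.
    by apply: eq_bigr => j jk; rewrite /B' dfwithout// eq_sym.
  apply/seteqP; split=> [[x y]/= Bxy|[x y]/= [B'x By] j].
    split=> [j|]; last by have := Bxy k; rewrite /resample dfwithin.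
    rewrite /B'; have [ej|kj] := eqVneq k j.
      by case: j / ej; rewrite dfwithin.
    by have := Bxy j; rewrite /resample !dfwithout.
  rewrite /resample; have [ej|kj] := eqVneq k j.
    by case: j / ej; rewrite dfwithin.
  by have := B'x j; rewrite /B' !dfwithout.
- by move=> _; rewrite -ge0_fin_numE ?fin_num_measure.
Qed.

Implicit Types (h g : product_space T -> R).
Local Notation E_ := (cond_expectation mu).

Lemma bm_section h x k : bounded_measurable h ->
  bounded_measurable (fun y : T k => h (dfwith x k y)).
Proof. by move=> bh; apply: bm_comp bh _; exact: measurable_dfwith. Qed.

Lemma bm_subst h k (z : T k) : bounded_measurable h ->
  bounded_measurable (subst_op z h).
Proof. by move=> bh; apply: bm_comp bh _; exact: measurable_subst. Qed.

Let integrable_resample h k : bounded_measurable h ->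
  (P \x mu k)%E.-integrable setT (fun xy => (h (resample xy))%:E).
Proof.
move=> bh.
by have := bm_integrable (P \x mu k)%E (bm_comp bh (@measurable_resample k)).
Qed.

Lemma bm_cond_expectation h k : bounded_measurable h ->
  bounded_measurable (E_ k h).
Proof.
move=> bh; split.
  have /measurable_fubini_F mF := integrable_resample k bh.
  exact: (measurableT_comp (fine_measurable measurableT) mF).
have [_ [M hM]] := bh; exists M => x.
by apply: mean_norm_le => [|y]; [exact: (bm_section x k bh)|exact: hM].
Qed.

Lemma mean_cond_expectation h k : bounded_measurable h ->
  \int[P]_x E_ k h x = \int[P]_x h x.
Proof.
move=> bh; have ih := integrable_resample k bh.
transitivity (fine (\int[(P \x mu k)%E]_xy (h (resample xy))%:E)).
  rewrite -integral12_prod_meas1//; congr fine; apply: eq_integral => x _.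
  rewrite fineK//; apply: integrable_fin_num => //.
  exact: (bm_integrable (mu k) (bm_section x k bh)).
congr fine; transitivity (\int[distribution (P \x mu k)%E (@resample k)]_x (h x)%:E)%E.
  rewrite integral_pushforward//=.
  by apply/measurable_EFinP; case: bh.
apply: eq_measure_integral => A mA _; exact: distribution_resample.
Qed.

Lemma cond_expectation_const h k x (z : T k) : E_ k h (dfwith x k z) = E_ k h x.
Proof. by apply: eq_Rintegral => y _; rewrite /subst_op dfwith_idem. Qed.

Lemma cond_expectation_subst h k l x (z : T l) : k != l ->
  E_ k h (dfwith x l z) = E_ k (subst_op z h) x.
Proof. by move=> kl; apply: eq_Rintegral => y _; rewrite /subst_op dfwithC// eq_sym. Qed.

End substitution.

(** * Tensorization of entropy *)

Section tensorization.
Context (n : nat) (d : 'I_n -> measure_display)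
        (T : forall k, measurableType (d k)).
Context {R : realType} (mu : forall k, probability (T k) R).
Implicit Types (x : product_space T) (h g Y : product_space T -> R).
Local Notation P := (product_probability mu).
Local Notation E_ := (cond_expectation mu).

Definition cond_entropy (k : 'I_n) h : product_space T -> R :=
  fun x => entropy (mu k) (fun y => h (dfwith x k y)).

Definition avg (s : seq 'I_n) h : product_space T -> R := foldr E_ h s.

Lemma bm_avg s h : bounded_measurable h -> bounded_measurable (avg s h).
Proof. by move=> bh; elim: s => //= k s IH; exact: bm_cond_expectation. Qed.

Lemma mean_avg s h : bounded_measurable h ->
  \int[P]_x avg s h x = \int[P]_x h x.
Proof.
by move=> bh; elim: s => //= k s IH; rewrite mean_cond_expectation//; exact: bm_avg.
Qed.

Lemma avg_ge c s h : bounded_measurable h -> (forall x, c <= h x) ->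
  forall x, c <= avg s h x.
Proof.
move=> bh ch; elim: s => //= k s IH x.
rewrite -(mean_cst (mu k) c); apply: mean_le => [||y]; [exact: bm_cst|exact: (bm_section x k (bm_avg s bh))|exact: IH].
Qed.

Lemma avg_const s h k x (z : T k) : k \in s ->
  avg s h (dfwith x k z) = avg s h x.
Proof.
elim: s h x => //= l s IH h x; rewrite inE => /orP[/eqP kl|ks].
  by subst l; rewrite cond_expectation_const.
have [kl|kl] := eqVneq k l.
  by subst l; rewrite cond_expectation_const.
rewrite cond_expectation_subst 1?eq_sym//; apply: eq_Rintegral => y _.
by rewrite /subst_op; exact: IH.
Qed.

(** Move from [x] to [y] by changing one coordinate at a time. *)
Lemma constant_of_dfwith h : (forall k x (z : T k), h (dfwith x k z) = h x) ->
  forall x y, h x = h y.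
Proof.
move=> hc x y; pose w m : product_space T := fun k => if (k < m)%N then y k else x k.
have hw m : (m <= n)%N -> h (w m) = h x.
  elim: m => [_|m IH mn]; first by congr h; apply: functional_extensionality_dep.
  rewrite -(IH (ltnW mn)) -(hc (Ordinal mn) (w m) (y (Ordinal mn))); congr h.
  apply: functional_extensionality_dep => j; have [ej|kj] := eqVneq (Ordinal mn) j.
    by case: j / ej; rewrite dfwithin /w/= ltnSn.
  rewrite dfwithout// /w ltnS leq_eqVlt orb_idl// => /eqP jm; exfalso.
  by move/eqP: kj; apply; apply/val_inj.
rewrite -(hw n (leqnn n)); congr h.
by apply: functional_extensionality_dep => j; rewrite /w ltn_ord.
Qed.

(** Once all coordinates are integrated out nothing is left to depend on, and
    each step preserves the mean. *)
Lemma avg_enum h x : bounded_measurable h ->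
  avg (enum 'I_n) h x = \int[P]_x h x.
Proof.
move=> bh; rewrite -(mean_avg (enum 'I_n) bh) -[LHS](mean_cst P).
apply: eq_Rintegral => y _; apply: constant_of_dfwith => k z w.
by apply: avg_const; rewrite mem_enum.
Qed.

Lemma bm_lnexpR Y : bounded_measurable Y ->
  bounded_measurable (fun x => expR (Y x) * ln (expR (Y x))).
Proof. by move=> bY; under eq_fun do rewrite expRK; apply: bmM => //; exact: bm_expR. Qed.

Lemma expR_lb Y : bounded_measurable Y ->
  exists2 c, 0 < c & forall x, c <= expR (Y x).
Proof.
move=> [_ [M YM]]; exists (expR (- M)); first exact: expR_gt0.
by move=> x; rewrite ler_expR; have := YM x; rewrite ler_norml => /andP[].
Qed.

Lemma bm_cond_entropy k Y : bounded_measurable Y ->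
  bounded_measurable (cond_entropy k (fun x => expR (Y x))).
Proof.
move=> bY; have bh := bm_expR bY; have bE := bm_cond_expectation mu k bh.
apply: bmB; first exact: (bm_cond_expectation mu k (bm_lnexpR bY)).
have [c c0 hc] := expR_lb bY.
apply: (bmM bE); apply: (@bm_ln _ _ _ c (E_ k (fun x => expR (Y x)))) => //.
exact: (@avg_ge c [:: k]).
Qed.

(** Given the other coordinates, [ln F - ln (E_k F)] is an admissible dual
    variable in [entropy_dual_le], since [F / E_k F] has conditional mean [1];
    its mean against [expR Y] is therefore at most the conditional entropy. *)
Lemma entropy_step k s Y : bounded_measurable Y ->
  \int[P]_x (expR (Y x) * (ln (avg s (fun x => expR (Y x)) x) -
                          ln (avg (k :: s) (fun x => expR (Y x)) x))) <=
  \int[P]_x cond_entropy k (fun x => expR (Y x)) x.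
Proof.
move=> bY; rewrite /=; set F := avg s _; have bh := bm_expR bY; have [c c0 hc] := expR_lb bY.
have bF : bounded_measurable F by exact: bm_avg.
have bEF := bm_cond_expectation mu k bF.
have Fc : forall x, c <= F x by exact: avg_ge.
have EFc : forall x, c <= E_ k F x by exact: (@avg_ge c [:: k]).
have F0 x : 0 < F x by exact: lt_le_trans (Fc x).
have EF0 x : 0 < E_ k F x by exact: lt_le_trans (EFc x).
have blF := bm_ln c0 Fc bF; have blEF := bm_ln c0 EFc bEF.
have bv := bmB blF blEF.
have bhv := bmM bh bv.
rewrite -(mean_cond_expectation mu k bhv).
apply: mean_le => [||x]; first exact: bm_cond_expectation.
  exact: bm_cond_entropy.
apply: entropy_dual_le; first exact: (bm_section x k bY).
  exact: (bm_section x k bv).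
rewrite [leLHS](_ : _ = \int[mu k]_y ((E_ k F x)^-1 * F (dfwith x k y))); last first.
  apply: eq_Rintegral => y _; rewrite cond_expectation_const -ln_div ?posrE//.
  by rewrite lnK ?posrE ?divr_gt0// mulrC.
rewrite meanZ; last exact: (bm_section x k bF).
by rewrite [X in _ * X](_ : _ = E_ k F x)// mulVf// gt_eqF.
Qed.

(** Write [ln (expR Y) - ln (E (expR Y))] as a telescoping sum, integrating out
    one coordinate at a time, and bound each term by [entropy_step]. *)
Lemma entropy_tensorization Y : bounded_measurable Y ->
  entropy P (fun x => expR (Y x)) <=
  \sum_(k < n) \int[P]_x cond_entropy k (fun x => expR (Y x)) x.
Proof.
move=> bY; have bh := bm_expR bY; have [c c0 hc] := expR_lb bY.
have bl s : bounded_measurable (fun x => ln (avg s (fun x => expR (Y x)) x)).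
  by apply: (@bm_ln _ _ _ c); [|exact: avg_ge|exact: bm_avg].
have bhl s : bounded_measurable (fun x => expR (Y x) * ln (avg s (fun x => expR (Y x)) x)).
  exact: bmM.
have tele s : \int[P]_x (expR (Y x) * ln (expR (Y x))) -
    \int[P]_x (expR (Y x) * ln (avg s (fun x => expR (Y x)) x)) <=
    \sum_(k <- s) \int[P]_x cond_entropy k (fun x => expR (Y x)) x.
  elim: s => [|k s IH]; first by rewrite big_nil subrr.
  rewrite big_cons; have := entropy_step k s bY.
  rewrite [X in X <= _ -> _](_ : _ =
      \int[P]_x (expR (Y x) * ln (avg s (fun x => expR (Y x)) x)) -
      \int[P]_x (expR (Y x) * ln (avg (k :: s) (fun x => expR (Y x)) x))); last first.
    by rewrite -meanB//; apply: eq_Rintegral => x _; rewrite mulrBr.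
  by move: IH; lra.
have := tele (enum 'I_n); rewrite big_enum; apply: le_trans.
rewrite [X in _ <= _ - X](_ : _ =
    \int[P]_x expR (Y x) * ln (\int[P]_x expR (Y x)))//.
rewrite mulrC -meanZ//; apply: eq_Rintegral => x _.
by rewrite avg_enum// mulrC.
Qed.

End tensorization.

(** * Essential infimum over one coordinate *)

Section conditional_essential_infimum.
Context (n : nat) (d : 'I_n -> measure_display)
        (T : forall k, measurableType (d k)).
Context {R : realType} (mu : forall k, probability (T k) R).
Implicit Types (x : product_space T) (g : product_space T -> R).

Definition cond_ess_inf (l : 'I_n) g : product_space T -> R :=
  fun x => fine (ess_inf (mu l) (fun y => (g (dfwith x l y))%:E)).

Lemma cond_ess_inf_bounds l g x M : (forall x, `|g x| <= M) ->
  ((- M)%:E <= ess_inf (mu l) (fun y => (g (dfwith x l y))%:E) <= M%:E)%E.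
Proof.
move=> gM; apply/andP; split.
  apply/ess_infP; apply: aeW => y; rewrite lee_fin.
  by have := gM (dfwith x l y); rewrite ler_norml => /andP[].
rewrite -(@ess_inf_cst _ _ _ (mu l) M%:E); last first.
  by have := @probability_setT _ _ _ (mu l) => /= ->; exact: lte01.
apply: le_ess_inf; apply: aeW => y; rewrite lee_fin.
by have := gM (dfwith x l y); rewrite ler_norml => /andP[].
Qed.

Lemma EFin_cond_ess_inf l g x : bounded_measurable g ->
  (cond_ess_inf l g x)%:E = ess_inf (mu l) (fun y => (g (dfwith x l y))%:E).
Proof.
move=> [_ [M gM]]; have /andP[lo hi] := cond_ess_inf_bounds l x gM.
rewrite /cond_ess_inf fineK// fin_numE; apply/andP; split.
  by apply/eqP => e; move: lo; rewrite e.
by apply/eqP => e; move: hi; rewrite e.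
Qed.

Lemma le_cond_ess_infP l g x (c : R) : bounded_measurable g ->
  c <= cond_ess_inf l g x <-> {ae mu l, forall y, c <= g (dfwith x l y)}.
Proof.
move=> bg; rewrite -lee_fin EFin_cond_ess_inf//; split.
  by move=> /ess_infP; apply: filterS => y; rewrite lee_fin.
by move=> h; apply/ess_infP; apply: filterS h => y; rewrite lee_fin.
Qed.

Lemma cond_ess_inf_le_ae l g x : bounded_measurable g ->
  {ae mu l, forall y, cond_ess_inf l g x <= g (dfwith x l y)}.
Proof. by move=> bg; apply/le_cond_ess_infP. Qed.

(** Otherwise [g] would be at least [cond_ess_inf l g x + e] along the whole
    fibre. *)
Lemma lt_cond_ess_inf l g x e : bounded_measurable g -> 0 < e ->
  exists z, g (dfwith x l z) < cond_ess_inf l g x + e.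
Proof.
move=> bg e0; apply: contrapT => /forallNP h.
suff : cond_ess_inf l g x + e <= cond_ess_inf l g x by rewrite leNgt ltrDl e0.
apply/le_cond_ess_infP => //; apply: aeW => y.
by rewrite leNgt; apply/negP; exact: h.
Qed.

Lemma cond_ess_inf_const l g x z :
  cond_ess_inf l g (dfwith x l z) = cond_ess_inf l g x.
Proof.
by congr fine; congr ess_inf; apply/funext => y; rewrite dfwith_idem.
Qed.

(** The set where the essential infimum is at least [c] is the zero set of
    the measure of the section where [g < c], a measurable function by Fubini's
    theorem. *)
Lemma bm_cond_ess_inf l g : bounded_measurable g ->
  bounded_measurable (cond_ess_inf l g).
Proof.
move=> bg; have [mg [M gM]] := bg; split; last first.
  exists M => x; have := cond_ess_inf_bounds l x gM.
  by rewrite -EFin_cond_ess_inf// !lee_fin ler_norml.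
apply: (measurability _ (@RGenCInfty.measurableE R)) => //.
move=> _ [_ [c ->] <-]; rewrite setTI.
pose B : set (product_space T * T l) := [set xy | g (resample xy) < c].
have mB : measurable B.
  rewrite (_ : B = (g \o @resample _ _ _ l) @^-1` `]-oo, c[%classic).
    rewrite -[X in measurable X]setTI.
    by apply: (measurableT_comp mg (@measurable_resample _ _ _ l)).
  by apply/seteqP; split=> xy; rewrite /B /= in_itv.
have mphi := measurable_fun_xsection (mu l) mB.
rewrite (_ : _ @^-1` _ = (mu l \o xsection B) @^-1` [set 0%E]).
  by rewrite -[X in measurable X]setTI; exact: mphi.
have mBx x : measurable (xsection B x) by exact: measurable_xsection.
apply/seteqP; split=> x /=; rewrite in_itv/= andbT.
  move=> /(le_cond_ess_infP l x c bg) h; apply/measure_negligible => //.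
  by apply: negligibleS h => y /xsectionP /= yc cy; move: yc; rewrite /B/= ltNge cy.
move=> h; apply/(le_cond_ess_infP l x c bg).
exists (xsection B x); split => // y /= /negP; rewrite -ltNge => yc.
by apply/xsectionP.
Qed.

End conditional_essential_infimum.

(** * Variance *)

Section variance.
Context {R : realType} {d} {T : measurableType d} (P : probability T R).
Implicit Types (u w : T -> R).

Definition var u : R := \int[P]_x (u x - \int[P]_y u y) ^+ 2.

Lemma bm_dev u c : bounded_measurable u -> bounded_measurable (fun x => (u x - c) ^+ 2).
Proof. by move=> bu; apply: bm_sqr; exact: bmB. Qed.

Lemma var_ge0 u : 0 <= var u.
Proof. by apply: Rintegral_ge0 => x _; exact: sqr_ge0. Qed.

Lemma var_le u M : bounded_measurable u -> (forall x, `|u x| <= M) ->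
  var u <= (2 * M) ^+ 2.
Proof.
move=> bu uM; rewrite -[leRHS](mean_cst P); apply: mean_le => //.
  exact: bm_dev.
move=> x; have := mean_norm_le P bu uM; have := uM x.
rewrite -[(u x - _) ^+ 2]real_normK ?num_real// => h1 h2.
have M0 : 0 <= M by exact: le_trans h1.
rewrite lerXn2r ?nnegrE ?mulr_ge0//.
by apply: le_trans (ler_normB _ _) _; lra.
Qed.

(** Pointwise, with centred [U] and [W], one has
    [U^2 - (U - W)^2 <= 2 U W <= c U^2 + W^2 / c].  Keeping the parameter [c]
    replaces the triangle inequality for standard deviations and lets several
    such bounds be added before optimizing. *)
Lemma var_sub_le u w c : bounded_measurable u -> bounded_measurable w -> 0 < c ->
  var u - var (fun x => u x - w x) <= c * var u + c^-1 * var w.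
Proof.
move=> bu bw c0; rewrite /var meanB//; set mu := \int[P]_y u y; set mw := \int[P]_y w y.
have buw := bmB bu bw.
have b1 := bm_dev mu bu; have b2 := bm_dev mw bw; have b3 := bm_dev (mu - mw) buw.
rewrite -meanB// -!meanZ// -meanD; [|exact: bmZ|exact: bmZ].
apply: mean_le => [||x]; first exact: bmB.
  by apply: bmD; exact: bmZ.
rewrite -subr_ge0; set U := u x - mu; set W := w x - mw.
have -> : u x - w x - (mu - mw) = U - W by rewrite /U /W; ring.
have -> : c * U ^+ 2 + c^-1 * W ^+ 2 - (U ^+ 2 - (U - W) ^+ 2) =
  c^-1 * (c * U - W) ^+ 2 + W ^+ 2 by field; rewrite gt_eqF.
by rewrite addr_ge0 ?sqr_ge0// mulr_ge0 ?sqr_ge0// invr_ge0 ltW.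
Qed.

End variance.

(** The infimum over [c > 0] of [c A + B / c] is [2 sqrt (A B)]. *)
Lemma sqr_le_of_forall_scale {R : realType} (y A B : R) : 0 <= y -> 0 <= A -> 0 <= B ->
  (forall c, 0 < c -> y <= c * A + c^-1 * B) -> y ^+ 2 <= 4 * A * B.
Proof.
move=> y0 A0 B0 h; have [->|yn0] := eqVneq y 0.
  by rewrite expr0n/= !mulr_ge0.
have {}y0 : 0 < y by rewrite lt_def yn0.
have [A00|An0] := eqVneq A 0.
  (* For [A = 0] a large [c] makes the right-hand side smaller than [y]. *)
  have c0 : 0 < (B + 1) / y * 2 by rewrite mulr_gt0// divr_gt0// ltr_wpDl.
  have := h _ c0; rewrite A00 mulr0 add0r.
  have -> : ((B + 1) / y * 2)^-1 * B = y * (B / (2 * (B + 1))).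
    by field; rewrite yn0 gt_eqF//= ltr_wpDl.
  have : B / (2 * (B + 1)) <= 2^-1.
    by rewrite ler_pdivrMr ?mulr_gt0// ?ltr_wpDl//; lra.
  by move=> /(ler_wpM2l (ltW y0)); lra.
have {}A0 : 0 < A by rewrite lt_def An0.
have c0 : 0 < y / (2 * A) by rewrite divr_gt0// mulr_gt0.
have := h _ c0.
have -> : y / (2 * A) * A + (y / (2 * A))^-1 * B = y / 2 + 2 * A * B / y.
  by field; rewrite yn0 An0.
have : 2 * A * B / y * y = 2 * A * B by rewrite divfK.
set q := 2 * A * B / y => qy; rewrite -lerBlDl.
by move=> /(ler_wpM2r (ltW y0)); rewrite qy expr2; lra.
Qed.

(** * The sum of conditional variances is self-bounding *)

Section self_bound.
Context (n : nat) (d : 'I_n -> measure_display)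
        (T : forall k, measurableType (d k)).
Context {R : realType} (mu : forall k, probability (T k) R).
Implicit Types (x : product_space T) (h g : product_space T -> R).
Local Notation P := (product_probability mu).

Lemma cond_varianceE k h x :
  cond_variance mu k h x = var (mu k) (fun y => h (dfwith x k y)).
Proof.
by apply: eq_Rintegral => y _; rewrite /subst_op cond_expectation_const.
Qed.

Lemma cond_variance_const k h x (z : T k) :
  cond_variance mu k h (dfwith x k z) = cond_variance mu k h x.
Proof. exact: cond_expectation_const. Qed.

Lemma cond_variance_ge0 k h x : 0 <= cond_variance mu k h x.
Proof. by rewrite cond_varianceE var_ge0. Qed.

Lemma bm_cond_variance k h : bounded_measurable h ->
  bounded_measurable (cond_variance mu k h).
Proof.
move=> bh; apply: bm_cond_expectation; apply: bm_sqr; apply: bmB => //.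
exact: bm_cond_expectation.
Qed.

Lemma bm_sum_cond_variances h : bounded_measurable h ->
  bounded_measurable (sum_cond_variances mu h).
Proof. by move=> bh; apply: bm_sum => k; exact: bm_cond_variance. Qed.

Lemma sum_cond_variances_ge0 h x : 0 <= sum_cond_variances mu h x.
Proof. by apply: sumr_ge0 => k _; exact: cond_variance_ge0. Qed.

Context (f : product_space T -> R) (bf : bounded_measurable f).
Local Notation g := (sum_cond_variances mu f).

Definition interaction_at (l : 'I_n) x : R :=
  sup [set \sum_(k < n | k != l) cond_variance mu k (f \- subst_op z f) x
      | z in [set: T l]].

Lemma sum_cond_variance_sub_bounded : exists B, forall l x (z : T l),
  \sum_(k < n | k != l) cond_variance mu k (f \- subst_op z f) x <= B.
Proof.
have [_ [M fM]] := bf; exists (\sum_(k < n) (2 * (M + M)) ^+ 2) => l x z.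
rewrite [leRHS](bigID (fun k => k != l))/= -[leLHS]addr0 lerD//.
  apply: ler_sum => k kl; rewrite cond_varianceE; apply: var_le => [|y].
    by apply: (@bm_section _ _ _ _ (f \- subst_op z f)); apply: bmB => //; exact: bm_subst.
  by apply: le_trans (ler_normB _ _) _; rewrite lerD// fM.
by apply: sumr_ge0 => k _; exact: sqr_ge0.
Qed.

Lemma interaction_at_ge l x (z : T l) :
  \sum_(k < n | k != l) cond_variance mu k (f \- subst_op z f) x <=
  interaction_at l x.
Proof.
have [B hB] := sum_cond_variance_sub_bounded.
apply: ub_le_sup; last by exists z.
by exists B => _ [w _ <-]; exact: hB.
Qed.

Lemma interaction_at_ge0 l x : 0 <= interaction_at l x.
Proof.
apply: le_trans (interaction_at_ge x (x l)).
by apply: sumr_ge0 => k _; exact: cond_variance_ge0.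
Qed.

Lemma sum_interaction_at_le x :
  4 * \sum_(l < n) interaction_at l x <= interaction mu f ^+ 2.
Proof.
have [B hB] := sum_cond_variance_sub_bounded.
rewrite /interaction exprMn; set S := sup _.
have le x' : \sum_(l < n) interaction_at l x' <= S.
  apply: ub_le_sup; last by exists x'.
  exists (\sum_(l < n) B) => _ [w _ <-]; apply: ler_sum => l _.
  apply: ge_sup; first by eexists; exists (w l).
  by move=> _ [z _ <-]; exact: hB.
rewrite sqr_sqrtr; last first.
  by apply: le_trans (le x); apply: sumr_ge0 => l _; exact: interaction_at_ge0.
have -> : 2 ^+ 2 = 4 :> R by ring.
by rewrite ler_pM2l.
Qed.

(** The term [k = l] of [g] does not depend on the coordinate [l]; for the other
    terms, substituting [z] at [l] commutes with the variance in coordinate [k],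
    so that [var_sub_le] applies to [f] and [f - S^l_z f]. *)
Lemma sum_cond_variances_sub_le l x (z : T l) c : 0 < c ->
  g x - g (dfwith x l z) <= c * g x + c^-1 * interaction_at l x.
Proof.
move=> c0; apply: (@le_trans _ _ (c * g x + c^-1 *
    \sum_(k < n | k != l) cond_variance mu k (f \- subst_op z f) x)); last first.
  by rewrite lerD2l ler_wpM2l ?invr_ge0 ?(ltW c0)// interaction_at_ge.
rewrite /sum_cond_variances -sumrB (bigD1 l)//= [X in c * X](bigD1 l)//=.
rewrite cond_variance_const subrr mulrDr mulr_sumr mulr_sumr -addrA.
rewrite lerD ?mulr_ge0 ?(ltW c0) ?cond_variance_ge0// -big_split/=.
apply: ler_sum => k kl; rewrite !cond_varianceE.
have -> : (fun y => f (dfwith (dfwith x l z) k y)) =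
    (fun y => f (dfwith x k y) - (f \- subst_op z f) (dfwith x k y)).
  apply/funext => y /=; rewrite /subst_op opprB addrC subrK dfwithC//.
  by rewrite eq_sym.
apply: var_sub_le => //; first exact: (bm_section x k bf).
by apply: (@bm_section _ _ _ _ (f \- subst_op z f)); apply: bmB => //; exact: bm_subst.
Qed.

(** The positive part matters only on the null set where [g] lies below its
    essential infimum; it makes [deviation_sqr_le] hold at every point. *)
Definition deviation (l : 'I_n) x : R := Num.max (g x - cond_ess_inf mu l g x) 0.

Lemma bm_deviation l : bounded_measurable (deviation l).
Proof.
apply: bm_max => //; apply: bmB; first exact: bm_sum_cond_variances.
by apply: bm_cond_ess_inf; exact: bm_sum_cond_variances.
Qed.

(** The essential infimum is approached by values of [g] at points differing
    from [x] in the coordinate [l] only, so [sum_cond_variances_sub_le] passes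
    to it; optimizing over [c] gives the square. *)
Lemma deviation_sqr_le l x : deviation l x ^+ 2 <= 4 * g x * interaction_at l x.
Proof.
have bg := bm_sum_cond_variances bf.
apply: sqr_le_of_forall_scale.
- by rewrite le_max lexx orbT.
- exact: sum_cond_variances_ge0.
- exact: interaction_at_ge0.
move=> c c0; rewrite ge_max; apply/andP; split; last first.
  by rewrite addr_ge0// mulr_ge0 ?invr_ge0 ?(ltW c0) ?sum_cond_variances_ge0 ?interaction_at_ge0.
apply/ler_addgt0Pr => e e0; have [z hz] := lt_cond_ess_inf mu l x bg e0.
have := sum_cond_variances_sub_le x z c0; rewrite !lerBlDr => /le_trans; apply.
by rewrite -(addrA (_ + _) e) lerD2l addrC ltW.
Qed.

Lemma sum_deviation_sqr_le x :
  \sum_(l < n) deviation l x ^+ 2 <= interaction mu f ^+ 2 * g x.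
Proof.
apply: (@le_trans _ _ (\sum_(l < n) (g x * (4 * interaction_at l x)))).
  by apply: ler_sum => l _; apply: le_trans (deviation_sqr_le l x) _; rewrite mulrCA mulrA.
rewrite -mulr_sumr -mulr_sumr mulrC ler_wpM2r ?sum_cond_variances_ge0//.
exact: sum_interaction_at_le.
Qed.

(** Tensorize, and bound the entropy in coordinate [l] with the essential infimum
    as reference value, which is legitimate since it does not depend on that
    coordinate. *)
Lemma entropy_sum_cond_variances s : 0 <= s ->
  entropy P (fun x => expR (s * g x)) <=
  s ^+ 2 * (interaction mu f ^+ 2 / 2 * \int[P]_x (g x * expR (s * g x))).
Proof.
move=> s0; have bg := bm_sum_cond_variances bf.
have bsg := bmZ s bg; have bh := bm_expR bsg.
have bd l : bounded_measurable (fun x => 2^-1 * (expR (s * g x) * (s * deviation l x) ^+ 2)).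
  by apply: bmZ; apply: bmM => //; apply: bm_sqr; apply: bmZ; exact: bm_deviation.
apply: le_trans (entropy_tensorization mu bsg) _.
apply: (@le_trans _ _ (\sum_(l < n) \int[P]_x (2^-1 * (expR (s * g x) * (s * deviation l x) ^+ 2)))).
  apply: ler_sum => l _; rewrite -[leRHS](mean_cond_expectation mu l)//.
  apply: mean_le => [||x]; first exact: bm_cond_entropy.
    exact: bm_cond_expectation.
  have uae : {ae mu l, forall y, s * cond_ess_inf mu l g x <= s * g (dfwith x l y)}.
    by apply: filterS (cond_ess_inf_le_ae mu l x bg) => y; exact: ler_wpM2l.
  apply: le_trans (entropy_le_sqr (bm_section x l bsg) uae) _.
  rewrite [leRHS](_ : _ = \int[mu l]_y (2^-1 * (expR (s * g (dfwith x l y)) *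
     Num.max (s * g (dfwith x l y) - s * cond_ess_inf mu l g x) 0 ^+ 2)))//.
  apply: eq_Rintegral => y _; rewrite /subst_op /deviation cond_ess_inf_const.
  by rewrite maxr_pMr// mulr0 mulrBr.
rewrite -mean_sum//.
have bgh : bounded_measurable (fun x => g x * expR (s * g x)) by exact: bmM.
rewrite mulrA -meanZ//; apply: mean_le => [||x]; [exact: bm_sum|exact: bmZ|].
rewrite -mulr_sumr -mulr_sumr.
under eq_bigr do rewrite exprMn.
rewrite -mulr_sumr.
have := sum_deviation_sqr_le x.
move=> /(ler_wpM2l (mulr_ge0 (expR_ge0 (s * g x)) (sqr_ge0 s))).
move: (\sum_(l < n) deviation l x ^+ 2) (expR (s * g x)) (interaction mu f ^+ 2).
by move: (g x) => G D e J; lra.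
Qed.

End self_bound.

(** * The Bernstein bound *)

Section bernstein.
Context (n : nat) (d : 'I_n -> measure_display)
        (T : forall k, measurableType (d k)).
Context {R : realType} (mu : forall k, probability (T k) R).
Context (f : product_space T -> R) (bf : bounded_measurable f).
Local Notation P := (product_probability mu).
Local Notation g := (sum_cond_variances mu f).
Local Notation v := (\int[P]_x g x).

Let bg : bounded_measurable g := bm_sum_cond_variances mu bf.

Lemma interaction_ge0 : 0 <= interaction mu f.
Proof. by rewrite mulr_ge0 ?sqrtr_ge0. Qed.

(** [herbst] with [G] a multiple of the cumulant generating function of [g]
    itself, as the entropy bound involves the tilted mean of [g]. *)
Lemma cgf_sum_cond_variances_le a s : interaction mu f <= a -> 0 < s ->
  (1 - a ^+ 2 * s / 2) * cgf P g s <= s * v.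
Proof.
move=> Ja s0; have a0 : 0 <= a := le_trans interaction_ge0 Ja.
have := @herbst _ _ _ P g (fun r => a ^+ 2 / 2 * cgf P g r)
  (fun r => a ^+ 2 / 2 * ((\int[P]_x (g x * expR (r * g x))) / \int[P]_x expR (r * g x)))
  s bg s0.
have c0 : 0 <= a ^+ 2 / 2 by rewrite divr_ge0 ?sqr_ge0.
move=> H; have := H _ _ _; rewrite mulrDr => {}H.
suff : cgf P g s <= s * v + s * (a ^+ 2 / 2 * cgf P g s) by lra.
apply: H => r /andP[r0 rs].
- have := is_derive_cgf P r bg => dc; apply: is_derive_eq.
  by rewrite /GRing.scale/=; ring.
- rewrite mulr_ge0// ln_ge0// -(mean_cst P 1); apply: mean_le => //.
    by apply: bm_expR; exact: bmZ.
  move=> x; rewrite -expR0 ler_expR mulr_ge0 ?(ltW r0)//.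
  exact: sum_cond_variances_ge0.
- apply: le_trans (entropy_sum_cond_variances mu bf (ltW r0)) _.
  have m0 := mean_expR_gt0 P (bmZ r bg).
  rewrite /= -[leRHS]mulrA -(mulrA (a ^+ 2 / 2)) (divfK (lt0r_neq0 m0)).
  rewrite ler_wpM2l ?sqr_ge0// ler_wpM2r//.
    apply: Rintegral_ge0 => x _; rewrite mulr_ge0 ?expR_ge0//.
    exact: sum_cond_variances_ge0.
  by rewrite ler_pM2r ?invr_gt0// lerXn2r ?nnegrE// interaction_ge0.
Qed.

Context (b : R) (b0 : 0 <= b).
Hypothesis f_le : forall k x, f x - cond_expectation mu k f x <= b.

(** Tensorize and use [entropy_bernstein] in each coordinate; the conditional
    variance, being independent of that coordinate, can be moved inside the
    conditional mean. *)
Lemma entropy_le_sum_cond_variances s : 0 <= s -> s * b < 3 ->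
  entropy P (fun x => expR (s * f x)) <=
  s ^+ 2 / (2 * (1 - s * b / 3) ^+ 2) * \int[P]_x (g x * expR (s * f x)).
Proof.
move=> s0 sb; have bsf := bmZ s bf; have bh := bm_expR bsf.
apply: le_trans (entropy_tensorization mu bsf) _.
set c := s ^+ 2 / _.
have bgh k : bounded_measurable (fun x => cond_variance mu k f x * expR (s * f x)).
  by apply: bmM => //; exact: bm_cond_variance.
have -> : c * \int[P]_x (g x * expR (s * f x)) =
    \sum_(k < n) \int[P]_x (c * (cond_variance mu k f x * expR (s * f x))).
  rewrite -mean_sum => [|k]; last exact: bmZ.
  rewrite -meanZ; last exact: bmM.
  by apply: eq_Rintegral => x _; rewrite -mulr_sumr -mulr_suml.
apply: ler_sum => k _; rewrite -[leRHS](mean_cond_expectation mu k); last exact: bmZ.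
apply: mean_le => [||x]; first exact: bm_cond_entropy.
  by apply: bm_cond_expectation; exact: bmZ.
have bX := bm_section x k bf.
have Xb y : f (dfwith x k y) - \int[mu k]_y f (dfwith x k y) <= b.
  by have := f_le k (dfwith x k y); rewrite cond_expectation_const.
apply: le_trans (entropy_bernstein bX Xb s0 sb) _.
rewrite -/c -/(var (mu k) (fun y => f (dfwith x k y))) -cond_varianceE.
have bhx := bm_section x k bh.
have e1 := meanZ (mu k) (cond_variance mu k f x) bhx.
have e2 := meanZ (mu k) c (bmZ (cond_variance mu k f x) bhx).
rewrite e1 in e2; rewrite le_eqVlt; apply/predU1P; left; apply: etrans (esym e2) _.
apply: eq_Rintegral => y _.
by rewrite /subst_op cond_variance_const.
Qed.

(** Decoupling.  With [w = s / (1 - s b / 3)], [th = w / a] and [q = w a / 2], the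
    entropy bound for [f] has constant [q th], and both the duality inequality
    and the bound on the cumulant generating function of [g] lose the same factor
    [1 - q]: this choice of [th] maximizes the product of the two factors. *)
Lemma entropy_le_quadratic a s : interaction mu f <= a -> 0 < a -> 0 < s ->
  s * (b / 3 + a / 2) < 1 ->
  entropy P (fun x => expR (s * f x)) <=
  s ^+ 2 * (v / (2 * (1 - s * (b / 3 + a / 2)) ^+ 2)) * \int[P]_x expR (s * f x).
Proof.
move=> Ja a0 s0 sc; have bsf := bmZ s bf; have bh := bm_expR bsf.
have m0 := mean_expR_gt0 P bsf; set m := \int[P]_x expR (s * f x) in m0 *.
have sb0 : 0 <= s * b by rewrite mulr_ge0// ltW.
have sa0 : 0 < s * a by rewrite mulr_gt0.
have sb : s * b < 3 by lra.
have p0 : 0 < 1 - s * b / 3 by lra.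
pose w := s / (1 - s * b / 3); pose th := w / a; pose q := w * a / 2.
have w0 : 0 < w by rewrite divr_gt0.
have th0 : 0 < th by rewrite divr_gt0.
have q1 : q < 1.
  by rewrite /q /w ltr_pdivrMr// mul1r mulrAC ltr_pdivrMr//; lra.
have q0 : 0 < q by rewrite /q divr_gt0// mulr_gt0.
have ent1 := entropy_le_sum_cond_variances (ltW s0) sb.
set Ent := entropy _ _ in ent1 *.
set A := \int[P]_x _ in ent1.
have wE : s ^+ 2 / (2 * (1 - s * b / 3) ^+ 2) = q * th.
  rewrite /q /th /w; have := lt0r_neq0 p0; have := lt0r_neq0 a0.
  by move: (1 - s * b / 3) => D an Dn; field; rewrite ?an ?Dn.
rewrite wE in ent1.
have bthg := bmZ th bg.
set L := cgf P g th.
have Lm : expR L = \int[P]_x expR (th * g x).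
  by rewrite /L /cgf lnK// posrE; exact: mean_expR_gt0.
have ent2 : th * A - m * L <= Ent.
  have bv : bounded_measurable (fun x => th * g x - L) by exact: bmB.
  have := @entropy_dual_le _ _ _ P _ _ bsf bv.
  have -> : \int[P]_x expR (th * g x - L) = 1.
    transitivity (\int[P]_x (expR (- L) * expR (th * g x))).
      by apply: eq_Rintegral => x _; rewrite -expRD addrC.
    by rewrite meanZ; [rewrite -Lm expRN mulVf// gt_eqF// expR_gt0|exact: bm_expR].
  move=> /(_ (lexx _)); rewrite -/Ent; apply: le_trans.
  rewrite le_eqVlt; apply/predU1P; left.
  transitivity (\int[P]_x (th * (g x * expR (s * f x)) - L * expR (s * f x))).
    have bgh := bmM bg bh.
    rewrite (meanB P (bmZ th bgh) (bmZ L bh)) (meanZ P th bgh) (meanZ P L bh).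
    by rewrite -/m (mulrC L).
  by apply: eq_Rintegral => x _; ring.
have L3 : (1 - q) * L <= th * v.
  have -> : q = a ^+ 2 * th / 2 by rewrite /q /th; field; rewrite gt_eqF.
  exact: cgf_sum_cond_variances_le.
have ent3 : (1 - q) * Ent <= q * m * L.
  by have := ler_wpM2l (ltW q0) ent2; lra.
have ent4 : (1 - q) ^+ 2 * Ent <= q * th * v * m.
  have q1' : 0 <= 1 - q by lra.
  have := ler_wpM2l q1' ent3; have := ler_wpM2l (ltW (mulr_gt0 q0 m0)) L3.
  lra.
have q1n : 0 < (1 - q) ^+ 2 by rewrite exprn_gt0// subr_gt0.
rewrite -(ler_pM2l q1n); apply: le_trans ent4 _.
rewrite le_eqVlt; apply/predU1P; left.
have -> : 1 - q = (1 - s * (b / 3 + a / 2)) / (1 - s * b / 3).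
  have -> : 1 - s * (b / 3 + a / 2) = 1 - s * b / 3 - s * a / 2 by field.
  rewrite /q /w; have := lt0r_neq0 p0.
  by move: (1 - s * b / 3) => D Dn; field; rewrite ?Dn.
have sc0 : 0 < 1 - s * (b / 3 + a / 2) by rewrite subr_gt0.
rewrite -wE; have := lt0r_neq0 p0; have := lt0r_neq0 sc0.
move: (1 - s * b / 3) (1 - s * (b / 3 + a / 2)) (v) (m) => D F u m' Fn Dn.
by field; rewrite ?Dn ?Fn.
Qed.

(** [herbst] with [G r = r v / (2 (1 - r c))], whose derivative is the constant in
    [entropy_le_quadratic].  The slack [u >= v] allows [u > 0] even when the
    variance vanishes. *)
Lemma cgf_le a s u : interaction mu f <= a -> 0 < a -> v <= u -> 0 < s ->
  s * (b / 3 + a / 2) < 1 ->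
  cgf P f s <= s * \int[P]_x f x + s ^+ 2 * u / (2 * (1 - s * (b / 3 + a / 2))).
Proof.
move=> Ja a0 vu s0; set c := b / 3 + a / 2 => sc.
have c0 : 0 < c by rewrite ltr_wpDl ?divr_ge0// divr_gt0.
have v0 : 0 <= v by apply: Rintegral_ge0 => x _; exact: sum_cond_variances_ge0.
have rc r : 0 < r <= s -> 0 < 1 - r * c.
  by move=> /andP[r0 rs]; have := ler_wpM2r (ltW c0) rs; lra.
have scp : 0 < 1 - s * c by apply: rc; rewrite s0/=.
have := @herbst _ _ _ P f (fun r : R => r * (v / (2 * (1 - r * c))))
  (fun r => v / (2 * (1 - r * c) ^+ 2)) s bf s0.
move=> H; apply: (@le_trans _ _ (s * (\int[P]_x f x + s * (v / (2 * (1 - s * c)))))).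
  apply: H => r rs; have rp := rc r rs; move: (rs) => /andP[r0 rs'].
  - have den0 : 2 * (1 - r * c) != 0 by rewrite mulf_neq0// gt_eqF.
    have dden : is_derive r 1 (fun r : R => 2 * (1 - r * c)) (- 2 * c).
      apply: is_derive_eq; rewrite /GRing.scale/=; ring.
    have dinv := @is_deriveV _ (fun r : R => 2 * (1 - r * c)) _ _ _ den0 dden.
    apply: is_derive_eq; rewrite /GRing.scale/=; field.
    by rewrite gt_eqF.
  - by rewrite mulr_ge0 ?(ltW r0)// divr_ge0// mulr_ge0// ltW.
  - apply: entropy_le_quadratic => //.
    by have := ler_wpM2r (ltW c0) rs'; rewrite -/c; lra.
rewrite mulrDr lerD2l mulrA -expr2 -mulrA ler_wpM2l ?sqr_ge0//.
by rewrite ler_wpM2r// invr_ge0 mulr_ge0// ltW.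
Qed.

Lemma measurable_tail (m t : R) : measurable [set x | t < f x - m].
Proof.
rewrite -[X in measurable X]setTI.
rewrite (_ : [set x | _] = (fun x => f x - m) @^-1` `]t, +oo[%classic).
  have bfm : bounded_measurable (fun x => f x - m) by exact: bmB.
  by have [mf _] := bfm; exact: mf.
by apply/seteqP; split=> x /=; rewrite in_itv/= andbT.
Qed.

Lemma chernoff_tail t s : 0 < s ->
  fine (P [set x | t < f x - \int[P]_x f x]) <=
  expR (cgf P f s - s * \int[P]_x f x - s * t).
Proof.
move=> s0; set m := \int[P]_x f x; set A := [set x | _].
have mA : measurable A by exact: measurable_tail.
have bsf := bmZ s bf.
have bA : bounded_measurable (\1_A : product_space T -> R).
  split; first exact: measurable_indic.
  by exists 1 => x; rewrite indicE; case: (x \in A); rewrite ?normr1 ?normr0.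
have -> : fine (P A) = \int[P]_x (\1_A x : R).
  by rewrite /Rintegral integral_indic// setIT.
apply: (@le_trans _ _ (\int[P]_x (expR (- s * m - s * t) * expR (s * f x)))).
  apply: mean_le => //; first by apply: bmZ; exact: bm_expR.
  move=> x; rewrite indicE -expRD; case: (boolP (x \in A)) => xA; last exact: expR_ge0.
  rewrite -expR0 ler_expR; move: xA; rewrite inE /A/= => tx.
  by have := mulr_gt0 s0 (_ : 0 < f x - m - t); rewrite subr_gt0 => /(_ tx); lra.
rewrite meanZ; last exact: bm_expR.
have -> : \int[P]_x expR (s * f x) = expR (cgf P f s).
  by rewrite /cgf lnK// posrE; exact: mean_expR_gt0.
by rewrite -expRD ler_expR; lra.
Qed.

(** The optimal parameter [t / (u + c t)] is admissible only if [u > 0], and the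
    decoupling needs [a > 0]; hence the strict inequalities. *)
Lemma tail_le_slack t u a : 0 < t -> v < u -> interaction mu f < a ->
  fine (P [set x | t < f x - \int[P]_x f x]) <=
  expR (- t ^+ 2 / (2 * u + (2 * b / 3 + a) * t)).
Proof.
move=> t0 vu Ja; have a0 : 0 < a := le_lt_trans interaction_ge0 Ja.
have v0 : 0 <= v by apply: Rintegral_ge0 => x _; exact: sum_cond_variances_ge0.
have u0 : 0 < u := le_lt_trans v0 vu.
pose c := b / 3 + a / 2; have c0 : 0 < c by rewrite ltr_wpDl ?divr_ge0// divr_gt0.
have ct0 : 0 < c * t by rewrite mulr_gt0.
have uct : 0 < u + c * t by rewrite addr_gt0.
pose s := t / (u + c * t); have s0 : 0 < s by rewrite divr_gt0.
have sc : s * (b / 3 + a / 2) < 1.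
  by rewrite -/c /s mulrAC ltr_pdivrMr// mul1r mulrC ltrDr.
apply: le_trans (chernoff_tail t s0) _; rewrite ler_expR.
have := cgf_le (ltW Ja) a0 (ltW vu) s0 sc; set m := \int[P]_x f x => cg.
apply: (@le_trans _ _ (s ^+ 2 * u / (2 * (1 - s * (b / 3 + a / 2))) - s * t)).
  by lra.
rewrite le_eqVlt; apply/predU1P; left.
rewrite -/c (_ : 2 * u + (2 * b / 3 + a) * t = 2 * (u + c * t)); last first.
  by rewrite /c; field.
have -> : 1 - s * c = u / (u + c * t) by rewrite /s; field; rewrite gt_eqF.
by rewrite /s; field; rewrite !gt_eqF.
Qed.

(** Letting the slack in [tail_le_slack] tend to zero, after taking logarithms:
    this form is linear in the denominator and so also covers a vanishing one. *)
Lemma tail_le t (p := fine (P [set x | t < f x - \int[P]_x f x])) : 0 < t ->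
  0 < p -> (2 * v + (2 * b / 3 + interaction mu f) * t) * ln p <= - t ^+ 2.
Proof.
move=> t0 p0; set D := 2 * v + _.
have D0 : 0 <= D.
  rewrite addr_ge0 ?mulr_ge0 ?(ltW t0)//.
    by apply: Rintegral_ge0 => x _; exact: sum_cond_variances_ge0.
  by rewrite addr_ge0 ?interaction_ge0// divr_ge0// mulr_ge0.
have slack e : 0 < e -> (D + e) * ln p <= - t ^+ 2.
  move=> e0; have vu : v < v + e / 4 by rewrite ltrDl divr_gt0.
  have Ja : interaction mu f < interaction mu f + e / (2 * t).
    by rewrite ltrDl divr_gt0// mulr_gt0.
  have := tail_le_slack t0 vu Ja; rewrite -/p.
  rewrite (_ : 2 * (v + e / 4) + _ = D + e); last first.
    rewrite /D; have := lt0r_neq0 t0.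
    by move: (v) (interaction mu f) => V J tn; field.
  have De : 0 < D + e by rewrite ltr_wpDl.
  rewrite -ler_ln ?posrE ?expR_gt0// expRK => h.
  by rewrite mulrC -ler_pdivlMr.
apply/ler_addgt0Pr => e e0.
have q0 : 0 < `|ln p| + 1 by rewrite ltr_wpDl.
have := slack (e / (`|ln p| + 1)) (divr_gt0 e0 q0).
have : - e <= e / (`|ln p| + 1) * ln p.
  rewrite mulrAC ler_pdivlMr// mulNr -mulrN ler_pM2l//.
  by have := ler_norm (- ln p); rewrite normrN; lra.
by rewrite mulrDl; move: (D * ln p) (e / _ * _) => A B; lra.
Qed.

End bernstein.

Theorem theorem3 (R : realType) (n : nat) (d : 'I_n -> measure_display)
    (T : forall k : 'I_n, measurableType (d k))
    (mu : forall k : 'I_n, probability (T k) R)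
    (f : product_space T -> R) (b : R)
    (f_measurable : measurable_fun [set: product_space T] f)
    (f_bounded : [bounded f x | x in [set: product_space T]])
    (f_le : forall (k : 'I_n) (x : product_space T),
      f x - cond_expectation mu k f x <= b)
    (t : R) (t_gt0 : 0 < t) :
  let P := product_probability mu in
  let Ef := \int[P]_x f x in
  let D := 2 * (\int[P]_x sum_cond_variances mu f x)
           + (2 * b / 3 + interaction mu f) * t in
  (P [set x | (t < f x - Ef)%R]
    <= expeR (if (D == 0)%R then -oo else (- t ^+ 2 / D)%:E) : Prop)%E.
Proof.
have bf : bounded_measurable f.
  split=> //; have [M [_ fM]] := f_bounded.
  by exists (M + 1) => x; apply: fM => //; rewrite ltrDl.
move=> P Ef; set v := \int[P]_x _; move=> D.
(* A product without factors is a single point, where [f] equals its mean. *)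
have [n0|n0] := posnP n.
  rewrite (_ : [set x | _] = set0) ?measure0 ?expeR_ge0//.
  apply/seteqP; split=> // x /=.
  suff -> : Ef = f x by rewrite subrr ltNge ltW.
  rewrite -[RHS](mean_cst P); apply: eq_Rintegral => y _.
  apply: constant_of_dfwith => k; exfalso.
  by have := leq_ltn_trans (leq0n k) (ltn_ord k); rewrite n0.
(* [f - E_k f] has conditional mean [0]. *)
have b0 : 0 <= b.
  pose k := Ordinal n0; pose x : product_space T := point.
  have bX := bm_section x k bf.
  rewrite -(subrr (\int[mu k]_y f (dfwith x k y))).
  rewrite -[X in _ - X](mean_cst (mu k)) -meanB// -[leRHS](mean_cst (mu k)).
  apply: mean_le => [||y] //; first exact: bmB.
  by have := f_le k (dfwith x k y); rewrite cond_expectation_const.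
have Afin : P [set x | t < f x - Ef] \is a fin_num.
  by apply: fin_num_measure; exact: measurable_tail.
have tail := tail_le bf b0 f_le t_gt0.
rewrite -(fineK Afin); set p := fine _ in tail *.
have [p0|p0] := leP p 0.
  by apply: le_trans (expeR_ge0 _); rewrite lee_fin.
have {}tail : D * ln p <= - t ^+ 2 := tail p0.
have D0 : 0 < D.
  rewrite lt_def; apply/andP; split.
    apply/eqP => D0; move: tail; rewrite D0 mul0r oppr_ge0 leNgt.
    by rewrite exprn_gt0.
  rewrite addr_ge0//.
    by rewrite mulr_ge0//; apply: Rintegral_ge0 => x _; exact: sum_cond_variances_ge0.
  rewrite mulr_ge0 ?(ltW t_gt0)// addr_ge0 ?interaction_ge0//.
  by rewrite divr_ge0// mulr_ge0.
rewrite gt_eqF//= lee_fin -[leLHS]lnK ?posrE// ler_expR.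
by rewrite ler_pdivlMr// mulrC.
Qed.
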